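(* Let $p$ be an odd prime. There exist a henselian perfect valued field $(K,v)$ of rank one and characteristic $p$, an immediate extension $(K(X)|K,w)$ of valued function fields of transcendence degree one, and a polynomial $f(X)\in K[X]$ such that $$h_K(X:f)=p\le h_K(X:F)\quad\text{for all } F\in K[X]\text{ with } F\equiv f \bmod \mathcal P(K[X]).$$ Furthermore, after fixing an extension of $w$ to $\overline{K(X)}$, there exists a polynomial $G\in K[X]$ such that $$G\equiv f \bmod \mathcal P(K(X)^h)\quad\text{and}\quad h_K(X:G)=1.$$ Consequently, if $\theta\in\overline{K(X)}$ satisfies $\theta^p-\theta=f$, then the extension $(K(X,\theta)|K,w)$ is henselian rational.
   Context: An extension of valued fields $(F|K,w)$ (with $v=w|_K$) is immediate if $wF=vK$ and $Fw=Kv$. Artin-Schreier operator: for a ring $R$ of characteristic $p$, $\mathcal P(R):=\{g^p-g\mid g\in R\}$, an additive subgroup of $R$; $F\equiv f\bmod\mathcal P(R)$ means $F-f\in\mathcal P(R)$. Henselizations are taken in $\overline{K(X)}$ with respect to the fixed extension of $w$; $E^h$ denotes the henselization of $E$. Relative approximation degree: a sequence $\{z_\nu\}_{\nu<\lambda}\subset K$ ($\lambda$ a limit ordinal) is pseudo-convergent if $v(z_\nu-z_\mu)<v(z_\mu-z_\rho)$ for all $\nu<\mu<\rho<\lambda$; an element $Y$ of a valued extension field is a limit if $w(Y-z_\nu)=v(z_\nu-z_{\nu+1})$ for all $\nu$. For an immediate extension $(K(X)|K,w)$ with $X$ transcendental, fix a pseudo-convergent sequence $\{z_\nu\}_{\nu<\lambda}\subset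 K$ without limit in $K$ and with $X$ as a limit. For $f\in K[X]$, if there exist $\nu_0<\lambda$, a positive integer $h$ and $\beta\in vK$ with $w(f(X)-f(z_\nu))=\beta+h\,w(X-z_\nu)$ for all $\nu_0<\nu<\lambda$, then $h_K(X:f):=h$. When $(K,v)$ is henselian, $h_K(X:f)$ exists for every nonconstant $f\in K[X]$. Henselian rational: an immediate extension $(F|K,w)$ of valued function fields of transcendence degree one (with $w$ extended to $\overline F$) is henselian rational if there is $Y\in F^h$ transcendental over $K$ with $F^h=K(Y)^h$. *)

(* Defs.v *)
From mathcomp Require Export all_boot all_order all_algebra.
From mathcomp Require Export boolp classical_sets.

Set Implicit Arguments.
Unset Strict Implicit.
Unset Printing Implicit Defensive.

Import Order.TTheory GRing.Theory Num.Theory.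

Local Open Scope classical_set_scope.
Local Open Scope ring_scope.

(* Totally ordered abelian groups. *)
Record orderedGroupType := OrderedGroupType {
  ordered_group_sort :> porderZmodType;
  ordered_group_total : total (<=%O : rel ordered_group_sort);
  ordered_group_leD2l : forall x y z : ordered_group_sort,
    y <= z -> x + y <= x + z
}.

(* [option G] stands for G together with infinity, [None] being infinity. *)
Section ExtendedGroup.
Context {G : orderedGroupType}.
Implicit Types a b : option G.

Definition vle a b : bool :=
  match a, b with
  | _, None => true
  | None, Some _ => false
  | Some x, Some y => x <= y
  end.

Definition vlt a b : bool := ~~ vle b a.

Definition vmin a b : option G := if vle a b then a else b.

Definition vadd a b : option G :=
  obind (fun x => omap (fun y => x + y) b) a.

(* H is a convex subgroup of the subgroup D of G. *)
Definition convex_subgroup (D H : set G) : Prop :=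
  [/\ H `<=` D, zmod_closed (mem H)
    & forall x y, H x -> D y -> 0 <= y <= x -> H y].

(* Exactly one convex subgroup of D is proper, namely 0. *)
Definition rank_one (D : set G) : Prop :=
  D <> [set 0] /\
  forall H, convex_subgroup D H -> H = [set 0] \/ H = D.

End ExtendedGroup.

(* Krull valuations, written additively. The value group is the set of finite
   values, which need not exhaust G. *)
Record valuation (F : fieldType) (G : orderedGroupType) := Valuation {
  valuation_fun :> F -> option G;
  valuation_eq0 : forall x, valuation_fun x = None <-> x = 0;
  valuationM : forall x y,
    valuation_fun (x * y) = vadd (valuation_fun x) (valuation_fun y);
  valuationD : forall x y,
    vle (vmin (valuation_fun x) (valuation_fun y)) (valuation_fun (x + y))
}.

(* A valued subfield of (F, w) is given by its carrier E : set F, its valuation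
   being the restriction of w. *)
Section ValuedSubfields.
Context {F : fieldType} {G : orderedGroupType} (w : valuation F G).
Implicit Types (E : set F) (x y : F).

Definition value_group E : set G :=
  [set g | exists2 x, E x & w x = Some g].

Definition valuation_ring E : set F :=
  [set x | E x /\ vle (Some 0) (w x)].

(* The residue of x is represented by its class modulo the maximal ideal of the
   valuation ring of F, so that the residue field of E is a subset of that of
   F. *)
Definition residue x : set F := [set y | vlt (Some 0) (w (y - x))].

Definition residue_field E : set (set F) :=
  [set residue x | x in valuation_ring E].

Definition immediate (K E : set F) : Prop :=
  value_group E = value_group K /\ residue_field E = residue_field K.

(* Hensel's Lemma. *)
Definition henselian E : Prop :=
  forall (q : {poly F}) (a : F),
    (forall i, valuation_ring E q`_i) -> valuation_ring E a ->
    vlt (Some 0) (w q.[a]) -> w q^`().[a] = Some 0 ->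
    exists b, [/\ valuation_ring E b, root q b & vlt (Some 0) (w (b - a))].

Definition subfield E : Prop := divring_closed (mem E).

Definition generated_subfield (A : set F) : set F := smallest subfield A.

(* When F is an algebraic closure of E, this is the henselization of E in F
   with respect to w: the least henselian subfield of F containing E. *)
Definition henselization E : set F :=
  smallest (fun H => subfield H /\ henselian H) E.

(* To be used for a function field E of transcendence degree one over the image
   of k, F being an algebraic closure of E. *)
Definition henselian_rational (K : fieldType) (k : K -> F) E : Prop :=
  immediate (range k) E /\
  exists Y : F, [/\ henselization E Y, ~ algebraicOver k Y
    & henselization E =
      henselization (generated_subfield (range k `|` [set Y]))].

End ValuedSubfields.

Definition perfect_of_char (p : nat) (K : fieldType) : Prop :=
  p \in [pchar K] /\ forall x : K, exists y : K, y ^+ p = x.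

(* The image of R under the Artin-Schreier operator. *)
Definition artin_schreier (p : nat) (A : nzRingType) (R : set A) : set A :=
  [set g ^+ p - g | g in R].

(* A limit ordinal, as the order type of a well-ordered set. *)
Definition limit_ordinal (d : Order.disp_t) (I : orderType d) : Prop :=
  [/\ inhabited I, well_founded (fun i j : I => (i < j)%O)
    & forall i : I, exists j : I, (i < j)%O].

Definition successor (d : Order.disp_t) (I : orderType d) (i j : I) : Prop :=
  (i < j)%O /\ forall k : I, (i < k)%O -> (j <= k)%O.

Section PseudoConvergence.
Context {F : fieldType} {G : orderedGroupType} (w : valuation F G).
Context {d : Order.disp_t} {I : orderType d} (z : I -> F).

Definition pseudo_convergent : Prop :=
  forall i j k : I, (i < j)%O -> (j < k)%O ->
    vlt (w (z i - z j)) (w (z j - z k)).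

Definition pseudo_limit (y : F) : Prop :=
  forall i j : I, successor i j -> w (y - z i) = w (z i - z j).

End PseudoConvergence.

(* K(X), with the embeddings of K[X] and K. *)
Notation ratfun K := {fraction {poly K}}.

Definition rat_poly {K : fieldType} : {poly K} -> ratfun K := @tofrac {poly K}.

Definition rat_const {K : fieldType} (a : K) : ratfun K := rat_poly a%:P.

Section RelativeApproximationDegree.
Context {K : fieldType} {G : orderedGroupType}.
Context (v : valuation K G) (w : valuation (ratfun K) G).
Context {d : Order.disp_t} {I : orderType d} (z : I -> K).

Definition approximating : Prop :=
  [/\ limit_ordinal I, pseudo_convergent v z,
      ~ (exists a : K, pseudo_limit v z a)
    & pseudo_limit w (rat_const \o z) (rat_poly 'X)].

(* h_K(X : f) = h. Such an h is unique when z is approximating. *)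
Definition approx_degree (f : {poly K}) (h : nat) : Prop :=
  (0 < h)%N /\
  exists (i0 : I) (beta : G), value_group v setT beta /\
    forall i : I, (i0 < i)%O ->
      w (rat_poly f - rat_const f.[z i])
      = omap (fun g => beta + g *+ h) (w (rat_poly 'X - rat_const (z i))).

End RelativeApproximationDegree.

(* Main.v *)
From HB Require Import structures.
Require Import Defs.
From mathcomp Require Import all_boot all_order all_algebra all_field.
From mathcomp Require Import boolp classical_sets.
From mathcomp Require Import ring lra zify.

(** Put [P = X^p - X - 1/t].  The field K is the closure, in an algebraic closure O
    of F_p(t) with a t-adic valuation v, of the perfect hull of F_p(t).  It contains the
    partial sums of [t^(-1/p) + t^(-1/p^2) + ...], which are a pseudo-convergent sequence
    with limit a root [alpha] of [P]; their distances to [alpha] increase to 0, and no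
    element c of K satisfies [v (alpha - c) >= 0].  As O is countable, some power series s
    in t differs from every element of O, and [X = alpha + s] defines an immediate
    extension [K(X)] with [w (P(X)) > 0].

    Expanding F in powers of P shows that [w (F(X) - F(c))] is eventually of the form
    [l + h w (X - c)], where h is 1 or a multiple of p: the values of a polynomial of
    degree < p are eventually constant, by Hensel's lemma, and [v (P(c)) = p w (X - c)].
    Let [f = P^2 - X^(2p) + X^2].  If F = f modulo the Artin-Schreier image of [K[X]], then
    [F = P^2 + e^p - e], where the degree of [P^2] is 2p and that of [e] is not 2, p being
    odd.  So the two parts of F do not cancel and its degree is at least p.

    As [w (P(X)^2) > 0], Hensel's lemma puts [P^2], hence f, in the Artin-Schreier image of
    [K(X)^h].  The same holds for [e X] if v(e) is large, and [theta] is in [K(X)^h]. *)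

Set Implicit Arguments.
Unset Strict Implicit.
Unset Printing Implicit Defensive.

Import Order.TTheory GRing.Theory Num.Theory.

Local Open Scope classical_set_scope.
Local Open Scope ring_scope.

(** * Valuations with values in an ordered group *)

(** The square is what prevents a smaller degree. P itself is congruent to the constant -1/t, and
    adding to this constant the Artin-Schreier image of uX with v(u) > 0 gives degree 1. For P^2 no
    choice of e cancels the dominant value, but its degree is 2p. The image of -X^2 is added to
    bring this down to p: the value of X^2 - c^2 is w(X) + w(X - c), and p (w(X) + w(X - c)) < 2p
    w(X - c) once c is closer to X than 0 is.

    The field K has to be henselian and yet leave room for s outside it. A closure taken inside O
    meets both demands: the roots that Hensel's lemma asks for exist in O and Newton's iteration
    converges to them, while everything stays countable. The root alpha is algebraic over K and
    cannot serve as X. As the value of s is positive and every v(alpha - c) is negative, adding s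
    changes none of these distances, and P(X) = s^p - s. *)

Section OrderedGroup.
Context {G : orderedGroupType}.
Implicit Types (a b c : G).

Lemma og_ltNge a b : (a < b) = ~~ (b <= a).
Proof.
have := ordered_group_total a b; rewrite lt_neqAle.
case: (boolP (a <= b)) => [ab _|_ /= ->]; last by rewrite andbF.
rewrite andbT; congr (~~ _); apply/eqP/idP => [->//|ba].
by apply/le_anti; rewrite ab.
Qed.

Lemma og_leNgt a b : (a <= b) = ~~ (b < a).
Proof. by rewrite og_ltNge negbK. Qed.

Lemma og_leD2l c a b : (c + a <= c + b) = (a <= b).
Proof.
apply/idP/idP => [|]; last exact: ordered_group_leD2l.
by move=> /(ordered_group_leD2l (- c)); rewrite !addKr.
Qed.

Lemma og_ltD2l c a b : (c + a < c + b) = (a < b).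
Proof. by rewrite !og_ltNge og_leD2l. Qed.

Lemma og_leD a b c d : a <= b -> c <= d -> a + c <= b + d.
Proof.
move=> ab cd; apply: (@le_trans _ _ (a + d)); first by rewrite og_leD2l.
by rewrite ![_ + d]addrC og_leD2l.
Qed.

Lemma og_ltleD a b c d : a < b -> c <= d -> a + c < b + d.
Proof.
move=> ab cd; apply: (@le_lt_trans _ _ (a + d)); first by rewrite og_leD2l.
by rewrite ![_ + d]addrC og_ltD2l.
Qed.

Lemma og_leMn n a b : a <= b -> a *+ n <= b *+ n.
Proof. by move=> ab; elim: n => // n IHn; rewrite !mulrS og_leD. Qed.

Lemma og_ltMn n a b : (0 < n)%N -> a < b -> a *+ n < b *+ n.
Proof.
case: n => // n _ ab; rewrite !mulrS; apply: og_ltleD => //.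
exact/og_leMn/ltW.
Qed.

Lemma og_Mn_inj n a b : (0 < n)%N -> a *+ n = b *+ n -> a = b.
Proof.
move=> n0 ab; apply/eqP; apply/negPn/negP => neq.
have := ordered_group_total a b; rewrite !le_eqVlt (negPf neq) eq_sym (negPf neq) /=.
by case/orP => /(og_ltMn n0); rewrite ab ltxx.
Qed.

End OrderedGroup.

Section ValuationTheory.
Context {F : fieldType} {G : orderedGroupType} (w : valuation F G).
Implicit Types (x y : F) (g h : G).

(** Bounds instead of values: both hold at 0, which then needs no separate case. *)
Definition vge g x := vle (Some g) (w x).
Definition vgt g x := vlt (Some g) (w x).

Lemma w0 : w 0 = None. Proof. exact/valuation_eq0. Qed.

Lemma w_some x : x != 0 -> exists g, w x = Some g.
Proof.
by case E: (w x) => [g|]; [exists g | move/valuation_eq0: E => ->; rewrite eqxx].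
Qed.

Lemma w_neq0 x g : w x = Some g -> x != 0.
Proof. by move=> wx; apply/eqP => x0; rewrite x0 w0 in wx. Qed.

Lemma wM x y g h : w x = Some g -> w y = Some h -> w (x * y) = Some (g + h).
Proof. by rewrite valuationM => -> ->. Qed.

Lemma w1 : w 1 = Some 0.
Proof.
have [g wg] := w_some (oner_neq0 F).
have := wM wg wg; rewrite mulr1 wg => -[/eqP].
by rewrite -subr_eq0 opprD addNKr oppr_eq0 => /eqP ->.
Qed.

Lemma wV x g : w x = Some g -> w x^-1 = Some (- g).
Proof.
move=> wx; have x0 := w_neq0 wx; have [h wh] : exists h, w x^-1 = Some h.
  by apply: w_some; rewrite invr_eq0.
have := wM wx wh; rewrite divff // w1 => -[/eqP].
by rewrite eq_sym addr_eq0 => /eqP ->; rewrite opprK wh.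
Qed.

Lemma wX x g n : w x = Some g -> w (x ^+ n) = Some (g *+ n).
Proof.
move=> wx; elim: n => [|n IHn]; first exact: w1.
by rewrite exprS mulrS (wM wx IHn).
Qed.

Lemma wN x : w (- x) = w x.
Proof.
have wN1 : w (-1) = Some 0.
  have [g wg] : exists g, w (-1) = Some g by apply: w_some; rewrite oppr_eq0 oner_eq0.
  have := wX 2 wg; rewrite sqrrN expr1n w1 => -[g2].
  by rewrite wg (@og_Mn_inj _ 2 g 0 isT) // mul0rn.
by rewrite -mulN1r valuationM wN1; case: (w x) => //= g; rewrite add0r.
Qed.

Lemma wBC x y : w (x - y) = w (y - x). Proof. by rewrite -wN opprB. Qed.

Lemma vgt0 g : vgt g 0. Proof. by rewrite /vgt w0. Qed.
Lemma vge0 g : vge g 0. Proof. by rewrite /vge w0. Qed.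

Lemma vgt_some x g h : w x = Some h -> vgt g x = (g < h).
Proof. by move=> wx; rewrite /vgt wx /vlt /= og_ltNge. Qed.

Lemma vge_some x g h : w x = Some h -> vge g x = (g <= h).
Proof. by move=> wx; rewrite /vge wx. Qed.

Lemma vgtW g x : vgt g x -> vge g x.
Proof.
rewrite /vgt /vge; case: (w x) => //= h.
by rewrite /vlt /= -og_ltNge => /ltW.
Qed.

Lemma vge_eq x g : w x = Some g -> vge g x.
Proof. by move=> wx; rewrite (vge_some _ wx) lexx. Qed.

Lemma vge_le g h x : h <= g -> vge g x -> vge h x.
Proof.
rewrite /vge; case: (w x) => //= k; exact: le_trans.
Qed.

Lemma vge_lt g h x : h < g -> vge g x -> vgt h x.
Proof.
rewrite /vge /vgt; case: (w x) => //= k; rewrite /vlt /= -og_ltNge.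
exact: lt_le_trans.
Qed.

Lemma vgt_le g h x : h <= g -> vgt g x -> vgt h x.
Proof.
rewrite /vgt; case: (w x) => //= k; rewrite /vlt /= -!og_ltNge.
exact: le_lt_trans.
Qed.

Lemma vgeD g x y : vge g x -> vge g y -> vge g (x + y).
Proof.
rewrite /vge => gx gy; have := valuationD w x y; rewrite /vmin.
case: ifP => _; case: (w (x + y)) => //= k; [move: gx | move: gy];
  by case: (w _) => //= ? ; exact: le_trans.
Qed.

Lemma vgtD g x y : vgt g x -> vgt g y -> vgt g (x + y).
Proof.
rewrite /vgt => gx gy; have := valuationD w x y; rewrite /vmin.
case: ifP => _; case: (w (x + y)) => //= k; [move: gx | move: gy];
  by case: (w _) => //= ?; rewrite /vlt /= -!og_ltNge; exact: lt_le_trans.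
Qed.

Lemma vgeN g x : vge g (- x) = vge g x. Proof. by rewrite /vge wN. Qed.
Lemma vgtN g x : vgt g (- x) = vgt g x. Proof. by rewrite /vgt wN. Qed.

Lemma vgeB g x y : vge g x -> vge g y -> vge g (x - y).
Proof. by move=> gx gy; apply: vgeD => //; rewrite vgeN. Qed.

Lemma vgtB g x y : vgt g x -> vgt g y -> vgt g (x - y).
Proof. by move=> gx gy; apply: vgtD => //; rewrite vgtN. Qed.

Lemma vgt_sum (I : Type) (r : seq I) (P : pred I) (f : I -> F) g :
  (forall i, P i -> vgt g (f i)) -> vgt g (\sum_(i <- r | P i) f i).
Proof.
move=> gf; apply: (big_ind (fun x => vgt g x)) => //; first exact: vgt0.
by move=> x y; exact: vgtD.
Qed.

Lemma vge_sum (I : Type) (r : seq I) (P : pred I) (f : I -> F) g :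
  (forall i, P i -> vge g (f i)) -> vge g (\sum_(i <- r | P i) f i).
Proof.
move=> gf; apply: (big_ind (fun x => vge g x)) => //; first exact: vge0.
by move=> x y; exact: vgeD.
Qed.

Lemma vgeM g h x y : vge g x -> vge h y -> vge (g + h) (x * y).
Proof.
rewrite /vge valuationM; case: (w x) => [a|] //; case: (w y) => [b|] //=.
exact: og_leD.
Qed.

Lemma vgtM g h x y : vgt g x -> vge h y -> vgt (g + h) (x * y).
Proof.
rewrite /vge /vgt valuationM; case: (w x) => [a|] //; case: (w y) => [b|] //=.
rewrite /vlt /= -!og_ltNge; exact: og_ltleD.
Qed.

Lemma vgeX g x n : vge g x -> vge (g *+ n) (x ^+ n).
Proof.
move=> gx; elim: n => [|n IHn]; first by rewrite /vge w1 /= lexx.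
by rewrite exprS mulrS vgeM.
Qed.

Lemma wDl x y g : w x = Some g -> vgt g y -> w (x + y) = Some g.
Proof.
move=> wx gy; case E: (w (x + y)) => [h|]; last first.
  move/valuation_eq0: E => /eqP; rewrite addr_eq0 => /eqP xy.
  by move: gy; rewrite -vgtN -xy (vgt_some _ wx) ltxx.
have : vge g (x + y) by apply: vgeD; [rewrite (vge_some _ wx) | exact: vgtW].
rewrite (vge_some _ E) le_eqVlt => /orP[/eqP -> //|gh].
have : vgt g (x + y - y) by apply: vgtB => //; rewrite (vgt_some _ E).
by rewrite addrK (vgt_some _ wx) ltxx.
Qed.

Lemma wBr x y g : w x = Some g -> vgt g (x - y) -> w y = Some g.
Proof.
by move=> wx xy; rewrite -(subKr x y); apply: wDl => //; rewrite vgtN.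
Qed.

Lemma vgt_total x g : vgt g x \/ exists2 h, w x = Some h & h <= g.
Proof.
rewrite /vgt; case E: (w x) => [h|]; last by left.
by rewrite /vlt /= -og_ltNge; case: (boolP (g < h)) => gh; [left | right; exists h;
  rewrite // og_leNgt].
Qed.

Lemma vge_total x g : vge g x \/ exists2 h, w x = Some h & h < g.
Proof.
rewrite /vge; case E: (w x) => [h|]; last by left.
by rewrite /=; case: (boolP (g <= h)) => gh; [left | right; exists h;
  rewrite // og_ltNge].
Qed.

Lemma vge0_nat n : vge 0 (n%:R).
Proof.
elim: n => [|n IHn]; first exact: vge0.
by rewrite -addn1 natrD; apply: vgeD => //; rewrite /vge w1 /= lexx.
Qed.

Lemma w_unity n x : (0 < n)%N -> x ^+ n = 1 -> w x = Some 0.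
Proof.
move=> n0 xn; have [g wg] : exists g, w x = Some g.
  apply: w_some; apply/eqP => x0; move: xn; rewrite x0 expr0n -[n == 0]negbK -lt0n n0 /=.
  by move/eqP; rewrite eq_sym oner_eq0.
have := wX n wg; rewrite xn w1 wg => -[/esym gn].
by rewrite (@og_Mn_inj _ n g 0 n0) // mul0rn.
Qed.

End ValuationTheory.

(** * Subfields given by their carriers *)

Section Subfields.
Context {F : fieldType}.
Implicit Types (E : set F).

Lemma subfieldP E : subfield E <->
  [/\ E 1, forall x y, E x -> E y -> E (x - y)
    & forall x y, E x -> E y -> E (x / y)].
Proof.
split=> -[E1 EB Ediv]; split; rewrite ?inE // in E1 *.
- by move=> x y Ex Ey; have := EB x y; rewrite !inE; apply.
- by move=> x y Ex Ey; have := Ediv x y; rewrite !inE; apply.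
- by move=> x y; rewrite !inE; apply: EB.
- by move=> x y; rewrite !inE; apply: Ediv.
Qed.

Lemma subfield_range (K : fieldType) (k : {rmorphism K -> F}) :
  subfield (range k).
Proof.
apply/subfieldP; split; first by exists 1; rewrite ?rmorph1.
- by move=> _ _ [x _ <-] [y _ <-]; exists (x - y); rewrite ?rmorphB.
- by move=> _ _ [x _ <-] [y _ <-]; exists (x / y); rewrite ?fmorph_div.
Qed.

Section Ops.
Variables (E : set F) (sE : subfield E).

Lemma subfield1 : E 1. Proof. by have /subfieldP[] := sE. Qed.

Lemma subfieldB x y : E x -> E y -> E (x - y).
Proof. by have /subfieldP[_ h _] := sE; exact: h. Qed.

Lemma subfield_div x y : E x -> E y -> E (x / y).
Proof. by have /subfieldP[_ _ h] := sE; exact: h. Qed.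

Lemma subfield0 : E 0.
Proof. by rewrite -(subrr 1); exact: subfieldB subfield1 subfield1. Qed.

Lemma subfieldN x : E x -> E (- x).
Proof. by move=> Ex; rewrite -sub0r; exact: subfieldB subfield0 Ex. Qed.

Lemma subfieldD x y : E x -> E y -> E (x + y).
Proof. by move=> Ex Ey; rewrite -[y]opprK; exact/subfieldB/subfieldN. Qed.

Lemma subfieldV x : E x -> E x^-1.
Proof. by move=> Ex; rewrite -div1r; exact: subfield_div subfield1 Ex. Qed.

Lemma subfieldM x y : E x -> E y -> E (x * y).
Proof. by move=> Ex Ey; rewrite -[y]invrK; exact/subfield_div/subfieldV. Qed.

Lemma subfieldX n x : E x -> E (x ^+ n).
Proof.
move=> Ex; elim: n => [|n IHn]; first exact: subfield1.
by rewrite exprS; exact: subfieldM.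
Qed.

Lemma subfield_nat n : E n%:R.
Proof.
elim: n => [|n IHn]; first exact: subfield0.
by rewrite -addn1 natrD; exact: subfieldD subfield1.
Qed.

Lemma subfield_sum (I : Type) (r : seq I) (P : pred I) (f : I -> F) :
  (forall i, P i -> E (f i)) -> E (\sum_(i <- r | P i) f i).
Proof.
move=> Ef; apply: (big_ind E) => //; first exact: subfield0.
exact: subfieldD.
Qed.

Lemma subfield_horner (q : {poly F}) x : (forall i, E q`_i) -> E x -> E q.[x].
Proof.
move=> Eq Ex; rewrite horner_coef; apply: subfield_sum => i _.
exact/subfieldM/subfieldX.
Qed.

End Ops.
End Subfields.

Section SubfieldType.
Variables (F : fieldType) (E : set F) (sE : subfield E).

(** The proof argument makes the predicate determine its closure proof, so that the algebraic
    instances can be attached to it. *)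
Definition subfield_pred (_ : subfield E) : {pred F} := mem E.

Let EP := subfield_pred sE.

Fact subfield_pred_closed : divring_closed EP. Proof. exact: sE. Qed.

HB.instance Definition _ := GRing.isDivringClosed.Build F EP subfield_pred_closed.

Record subfield_type := SubfieldType {
  subfield_val : F; subfield_valP : subfield_val \in EP }.

HB.instance Definition _ := [isSub for subfield_val].
HB.instance Definition _ := [Choice of subfield_type by <:].
HB.instance Definition _ :=
  [SubChoice_isSubIntegralDomain of subfield_type by <:].
HB.instance Definition _ := [SubIntegralDomain_isSubField of subfield_type by <:].

Lemma subfield_as_field :
  exists (K : fieldType) (k : {rmorphism K -> F}), range k = E.
Proof.
exists subfield_type, (val : {rmorphism subfield_type -> F}).
apply/seteqP; split=> [_ [x _ <-]|x Ex].
  by have := valP x; rewrite inE.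
have xE : x \in EP by rewrite inE.
by exists (SubfieldType xE).
Qed.

End SubfieldType.

(** * Topological closure of a valued subfield *)

Section Closure.
Context {F : fieldType} {G : orderedGroupType} (w : valuation F G).

(* The topological closure of [E] when the values of [E] are cofinal. *)
Definition vclosure (E : set F) : set F :=
  [set y | forall g, value_group w E g -> exists2 x, E x & vgt w g (y - x)].

Definition cofinal_values (E : set F) : Prop :=
  forall y h, w y = Some h -> exists2 g, value_group w E g & h <= g.

Variable E : set F.
Hypotheses (sE : subfield E) (cofE : cofinal_values E).
Let C := vclosure E.
Let D := value_group w E.

Let D0 : D 0. Proof. by exists 1; [exact: subfield1 | exact: w1]. Qed.

Let DD g h : D g -> D h -> D (g + h).
Proof.
by move=> [x Ex wx] [y Ey wy]; exists (x * y); [exact: subfieldM | exact: wM].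
Qed.

Let DN g : D g -> D (- g).
Proof. by move=> [x Ex wx]; exists x^-1; [exact: subfieldV | exact: wV]. Qed.

Let ap2 y g h : C y -> D g -> D h -> exists x, [/\ E x, vgt w g (y - x) & vgt w h (y - x)].
Proof.
move=> Cy Dg Dh; case/orP: (ordered_group_total g h) => gh.
  by have [x Ex yx] := Cy _ Dh; exists x; split=> //; exact: vgt_le yx.
by have [x Ex yx] := Cy _ Dg; exists x; split=> //; exact: vgt_le yx.
Qed.

Let lower y : exists2 g, D g & vge w (- g) y.
Proof.
have [->|y0] := eqVneq y 0; first by exists 0; rewrite ?vge0.
have [h wy] := w_some w y0; have [g Dg hg] := cofE (wV wy).
exists g => //; rewrite (vge_some _ wy) -(og_leD2l (g - h)).
by rewrite addrAC subrr add0r subrK.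
Qed.

Lemma sub_vclosure : E `<=` vclosure E.
Proof. by move=> x Ex g _; exists x => //; rewrite subrr vgt0. Qed.

(** Cofinality bounds every value from below by a value of [E] and lets [y] be approximated beyond
    its own value. The approximation then has the value of [y], and products and inverses are
    continuous. *)
Lemma vclosure_subfield : subfield (vclosure E).
Proof.
have CM y z : C y -> C z -> C (y * z).
  move=> Cy Cz g Dg; have [gy Dy wy] := lower y; have [gz Dz wz] := lower z.
  have [x [Ex yx1 yx2]] := ap2 Cy (DD Dg Dz) (DN Dy).
  have [x' Ex' zx] := Cz _ (DD Dg Dy).
  exists (x * x'); first exact: subfieldM.
  have -> : y * z - x * x' = (y - x) * z + (z - x') * x by ring.
  have wx : vge w (- gy) x by rewrite -(subKr y x); apply: vgeB => //; exact: vgtW.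
  by apply: vgtD; [have := vgtM yx1 wz | have := vgtM zx wx]; rewrite addrK.
have CV y : C y -> C y^-1.
  have [->|y0] := eqVneq y 0; first by rewrite invr0.
  have [h wy] := w_some w y0; have [g1 Dg1 hg1] := cofE wy.
  move=> Cy g Dg.
  have [x [Ex yx1 yx2]] := ap2 Cy Dg1 (DD Dg (DD Dg1 Dg1)).
  have wx : w x = Some h by apply: (wBr wy); exact: vgt_le yx1.
  exists x^-1; first exact: subfieldV.
  have x0 := w_neq0 wx.
  have -> : y^-1 - x^-1 = (y - x) * - (x^-1 * y^-1) by field; rewrite x0 y0.
  have wxy : vge w (- h - h) (- (x^-1 * y^-1)).
    by rewrite vgeN (vge_some _ (wM (wV wx) (wV wy))) lexx.
  apply: vgt_le (vgtM yx2 wxy).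
  have := og_leD (og_leD hg1 hg1) (lexx (- h - h)).
  rewrite -opprD subrr => h0.
  by rewrite -(og_leD2l g) addr0 addrA in h0.
apply/subfieldP; split; first by apply: sub_vclosure; exact: subfield1.
- move=> y z Cy Cz g Dg; have [x Ex yx] := Cy _ Dg; have [x' Ex' zx] := Cz _ Dg.
  exists (x - x'); first exact: subfieldB.
  have -> : y - z - (x - x') = (y - x) - (z - x') by ring.
  exact: vgtB.
- by move=> y z Cy Cz; apply: CM => //; exact: CV.
Qed.

End Closure.

(** An approximation beyond the value of [y] has the same value, and the same residue when that
    value is nonnegative. *)
Lemma dense_immediate (F : fieldType) (G : orderedGroupType) (w : valuation F G)
  (K0 E : set F) : K0 `<=` E -> K0 0 ->
  (forall y g, E y -> w y = Some g -> exists2 c, K0 c & vgt w g (y - c)) ->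
  immediate w K0 E.
Proof.
move=> sKE K0_0 dense; split; apply/seteqP; split.
- move=> g [y Ey wy]; have [c Kc yc] := dense _ _ Ey wy.
  by exists c => //; exact: wBr wy yc.
- by move=> g [c Kc wc]; exists c => //; exact: sKE.
- move=> _ [y [Ey wy] <-].
  have [c [Kc wc yc]] : exists c, [/\ K0 c, vge w 0 c & vgt w 0 (y - c)].
    case wyE: (w y) => [g|]; last first.
      by exists 0; split=> //; rewrite ?vge0 // subr0 /vgt wyE.
    have [c Kc yc] := dense _ _ Ey wyE; exists c; split => //.
      by rewrite (vge_some _ (wBr wyE yc)) -(vge_some _ wyE).
    by apply: vgt_le yc; rewrite -(vge_some _ wyE).
  exists c; first by split.
  apply/seteqP; split=> u uc; rewrite /residue /=.
    by rewrite (_ : u - y = (u - c) - (y - c)); [exact: vgtB | ring].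
  by rewrite (_ : u - c = (u - y) + (y - c)); [exact: vgtD | ring].
- by move=> _ [c [Kc wc] <-]; exists c => //; split=> //; exact: sKE.
Qed.

(** * Taylor expansions along a pseudo-limit *)

Fact rat_leD2l (x y z : rat) : y <= z -> x + y <= x + z.
Proof. by rewrite lerD2l. Qed.

Definition ratG : orderedGroupType :=
  OrderedGroupType (ordered_group_sort := rat) (@le_total _ rat) rat_leD2l.

(** Divided derivatives are used because in characteristic p the factorials vanish from p on. *)
Lemma taylor_sub (R : comNzRingType) (r : {poly R}) (x c : R) :
  r.[x] - r.[c] =
  \sum_(i < (size r).-1) r^`N(i.+1).[c] * (x - c) ^+ i.+1.
Proof.
rewrite -{1}(subrKC c x) (@nderiv_taylor_wide _ (size r).-1.+1) ?leqSpred //; last first.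
  exact: mulrC.
by rewrite big_ord_recl nderivn0 expr0 mulr1 addrAC subrr add0r.
Qed.

Lemma nderivn_deriv (R : nzSemiRingType) (r : {poly R}) i :
  r^`()^`N(i) = r^`N(i.+1) *+ i.+1.
Proof.
apply/polyP => j; rewrite coefMn !coef_nderivn coef_deriv -!mulrnA addSn.
by congr (_ *+ _); rewrite [RHS]mulnC -(mul_bin_diag (i + j).+1 i) /= ?addnS // mulnC.
Qed.

Lemma deriv_pchar_neq0 (F : fieldType) p (r : {poly F}) :
  p \in [pchar F] -> (1 < size r <= p)%N -> r^`() != 0.
Proof.
move=> p_char /andP[r1 rp]; have r0 : r != 0 by rewrite -size_poly_gt0 ltnW.
apply/eqP => /(congr1 (fun q : {poly F} => q`_(size r).-2)) /eqP.
rewrite coef_deriv coef0 (_ : (size r).-2.+1 = (size r).-1); last first.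
  by case: (size r) r1 => [|[|]].
rewrite -mulr_natr mulf_eq0 -/(lead_coef r) lead_coef_eq0 (negPf r0) /=.
by rewrite -(dvdn_pcharf p_char) gtnNdvd //; [case: (size r) r1 => [|[|]] |
  case: (size r) r1 rp => [|[|]] //].
Qed.

(** Modulo the maximal ideal [q] is the linear polynomial X + q_0. *)
Lemma hensel_scaled (K : fieldType) (G : orderedGroupType) (v : valuation K G)
    (q : {poly K}) :
  henselian v setT -> vge v 0 q`_0 -> q`_1 = 1 ->
  (forall i, vgt v 0 q`_i.+2) -> exists2 b, vge v 0 b & root q b.
Proof.
move=> hv q0 q1 q2; have v1 : vge v 0 1 by exact: vge_eq (w1 v).
have qi i : vge v 0 q`_i by case: i => [|[|i]] //; [rewrite q1 | exact: vgtW].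
have aX n : vge v 0 ((- q`_0) ^+ n).
  by rewrite -(mul0rn _ n); apply: vgeX; rewrite vgeN.
have [||||b [[_ vb] rb _]] := hv q (- q`_0) _ _ _ _; last by exists b.
- by move=> i; split => //; exact: qi.
- by split => //; exact: (aX 1%N).
- rewrite (@horner_coef_wide _ (size q).+2) ?leqW // !big_ord_recl /= q1.
  rewrite expr0 expr1 mulr1 mul1r addrA subrr add0r; apply: vgt_sum => i _.
  by rewrite -[X in vgt _ X]addr0; exact: vgtM.
rewrite (@horner_coef_wide _ (size q).+1); last first.
  have [->|q0'] := eqVneq q 0; first by rewrite deriv0 size_poly0.
  by rewrite leqW // ltnW // lt_size_deriv.
rewrite big_ord_recl /= coef_deriv q1 mulr1n expr0 mulr1.
apply: (wDl (w1 v)); apply: vgt_sum => i _; rewrite coef_deriv -mulr_natr -mulrA.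
rewrite -[X in vgt _ X]addr0; apply: vgtM (q2 _) _.
by rewrite -[X in vge _ X]addr0; apply: vgeM (vge0_nat _ _) _.
Qed.

(** * Polynomials of degree less than p *)

Section Stability.
Context (K M : fieldType) (v : valuation K ratG) (w : valuation M ratG).
Context (k : {rmorphism K -> M}) (x : M) (gam : K -> rat) (p : nat).
Hypotheses (p_char : p \in [pchar K]) (hv : henselian v setT).
Hypotheses (wk : forall c, w (k c) = v c).
Hypotheses (wx : forall c, w (x - k c) = Some (gam c)).
Hypotheses (gam_sup : forall d : rat, d < 0 -> exists c, d < gam c).
Hypotheses (gam_lt0 : forall c, gam c < 0).

Lemma vgt_k g c : vgt w g (k c) = vgt v g c.
Proof. by rewrite /vgt wk. Qed.

Lemma vge_k g c : vge w g (k c) = vge v g c.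
Proof. by rewrite /vge wk. Qed.

Lemma v_sub_center c c' : gam c < gam c' -> v (c' - c) = Some (gam c).
Proof.
move=> lt_c; rewrite -wk rmorphB (_ : _ - _ = (x - k c) - (x - k c')); last by ring.
by apply: wDl => //; rewrite vgtN (vgt_some _ (wx _)).
Qed.

(** By Fermat's little theorem [i] is a root of unity in [K]. *)
Lemma v_natr i : (0 < i < p)%N -> v i%:R = Some 0.
Proof.
move=> /andP[i0 ip]; have pp := pcharf_prime p_char.
apply: (@w_unity _ _ v p.-1); first by case: (p) pp => [|[|]].
have iF : i%:R ^+ p = i%:R :> K.
  by rewrite -(pFrobenius_autE p_char) pFrobenius_aut_nat.
have i0K : i%:R != 0 :> K.
  by rewrite -(dvdn_pcharf p_char) gtnNdvd.
apply: (mulfI i0K); rewrite -exprS prednK ?mulr1 // prime_gt0 //.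
Qed.

Lemma vgt_muln g y i : (0 < i < p)%N -> vgt v g (y *+ i) -> vgt v g y.
Proof.
move=> ip; have vi := wV (v_natr ip); have i0 := w_neq0 (v_natr ip).
rewrite -mulr_natr => gy; rewrite -(mulfK i0 y) -[X in vgt _ X]addr0.
by apply: vgtM => //; rewrite (vge_some _ vi) oppr0 lexx.
Qed.

(** The bound says that the constant Taylor term at [c] strictly dominates all others at distance
    [gam c]. *)
Let stable r := exists d rho : rat, d < 0 /\ forall c, d < gam c ->
  v r.[c] = Some rho /\
  forall i, vgt v (rho - gam c *+ i.+1) r^`N(i.+1).[c].

(** Induction through the derivative, which is nonzero because the degree is less than p. Its
    stability makes the linear Taylor term of [r] dominate the higher ones, so that only the
    constant and the linear term remain to be compared. *)
Lemma poly_stable (r : {poly K}) : (size r <= p)%N -> r != 0 -> stable r.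
Proof.
move: {-1}(size r) (leqnn (size r)) => n; elim: n r => [|n IHn] r.
  by rewrite leqn0 size_poly_eq0 => /eqP ->; rewrite eqxx.
move=> rn np r0; have [r1|r1] := leqP (size r) 1.
  rewrite (size1_polyC r1) in r0 *; have [g wg] : exists g, v r`_0 = Some g.
    by apply: w_some; rewrite polyC_eq0 in r0.
  exists (-1), g; split=> // c _; rewrite hornerC; split=> // i.
  by rewrite nderivnC horner0 vgt0.
have rp := leq_trans rn np.
have dr0 : r^`() != 0 by apply: (deriv_pchar_neq0 p_char); rewrite r1.
have [||d [rho [d0 dP]]] := IHn r^`() _ _ dr0.
- by rewrite -ltnS (leq_trans (lt_size_deriv r0)).
- exact: ltnW.
(* Up to the factor i + 2 these are the Taylor coefficients of the derivative. The factor is a unit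
   below [p], and from [p] on the coefficient vanishes. *)
have high i c : d < gam c -> vgt v (rho - gam c *+ i.+1) r^`N(i.+2).[c].
  move=> dc; have [_ /(_ i)] := dP c dc; rewrite nderivn_deriv hornerMn.
  have [ip|pi] := ltnP i.+2 p; first by apply: vgt_muln; rewrite ip.
  move=> _; rewrite (_ : _.[c] = 0) ?vgt0 //.
  by rewrite nderivn_poly0 ?horner0 // (leq_trans rp).
have r1E c : r^`N(1).[c] = r^`().[c] by rewrite nderivn1.
(* If the constant Taylor coefficient never dominates, Hensel's lemma gives a
   root of [r] in [K], and [r] is too small at the centres closer to [x]. *)
have [[c0 [dc0 lt0]]|nlt] := pselect (exists c0, d < gam c0 /\ ~ vge v (rho + gam c0) r.[c0]).
  (* The constant term dominates at [c0], hence at all closer centres, with the same value. *)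
  have [//|[rho' vr lt_rho]] := vge_total v r.[c0] (rho + gam c0).
  exists (gam c0), rho'; split=> // c lt_c; split; last first.
    move=> [|i].
      rewrite r1E (vgt_some _ (dP c _).1); last lra.
      move: lt_rho; rewrite /=. lra.
    apply: vgt_le (high i c _); last lra.
    move: lt_rho; rewrite /= ![_ *+ i.+2]mulrS; lra.
  have vcc := v_sub_center lt_c.
  rewrite -(subrK r.[c0] r.[c]) addrC; apply: wDl => //.
  rewrite taylor_sub; apply: vgt_sum => -[[|i] _] _ /=.
    rewrite r1E expr1 (vgt_some _ (wM (dP c0 dc0).1 vcc)); exact: lt_rho.
  apply: vgt_le (vgtM (high i c0 dc0) (vge_eq (wX _ vcc))).
  move: lt_rho; rewrite /= [_ *+ i.+2]mulrS; lra.
have ge c : d < gam c -> vge v (rho + gam c) r.[c].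
  by move=> dc; apply: contrapT => nge; apply: nlt; exists c.
exfalso.
have [c1 dc1] := gam_sup d0; have [c1' lt_c1] := gam_sup (gam_lt0 c1).
have vs := v_sub_center lt_c1; set s := c1' - c1 in vs.
have [vr1 _] := dP c1 dc1; set e := r^`().[c1] in vr1.
have vse := wV (wM vs vr1).
(* The expansion of r(c1 + s b) in powers of b, divided by s r'(c1), where v(s) is the distance
   [gam c1]. By [ge] its constant coefficient is integral, and by [high] the coefficients after the
   linear one have positive value. *)
pose q := \poly_(i < size r) (r^`N(i).[c1] * s ^+ i / (s * e)).
have qE i : q`_i = r^`N(i).[c1] * s ^+ i / (s * e).
  rewrite coef_poly; case: ltnP => // ri.
  by rewrite nderivn_poly0 // horner0 !mul0r.
have s0 := w_neq0 vs; have e0 := w_neq0 vr1.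
have [||i|b vb rb] := hensel_scaled (q := q) hv.
- rewrite qE expr0 mulr1 nderivn0.
  apply: vge_le (vgeM (ge c1 dc1) (vge_eq vse)).
  rewrite /=; lra.
- by rewrite qE expr1 r1E -/e; field; rewrite s0 e0.
- rewrite qE -mulrA; apply: vgt_le (vgtM (high i c1 dc1) (vge_eq (wM (wX _ vs) vse))).
  by rewrite /= [_ *+ i.+2]mulrS; lra.
pose c := c1 + s * b.
have rc : r.[c] = 0.
  transitivity (q.[b] * (s * e)); last by rewrite (rootP rb) mul0r.
  rewrite (nderiv_taylor _ (mulrC _ _)) horner_poly big_distrl /=.
  by apply: eq_bigr => i _; rewrite exprMn; field; rewrite s0 e0.
have c1c : gam c1 <= gam c.
  rewrite -(vge_some _ (wx c)) (_ : x - k c = (x - k c1) - k (s * b)); last first.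
    by rewrite /c rmorphD; ring.
  apply: vgeB; first exact: vge_eq.
  rewrite vge_k -[X in vge _ X]addr0; apply: vgeM vb.
  exact: vge_eq.
have dc : d < gam c by exact: lt_le_trans c1c.
have [c2 lt_c2] := gam_sup (gam_lt0 c).
have vcc := v_sub_center lt_c2.
have : v (r.[c2] - r.[c]) = Some (rho + gam c : rat).
  rewrite taylor_sub; case sz: (size r).-1 => [|m]; first by case: (size r) r1 sz => [|[|]].
  rewrite big_ord_recl /= r1E expr1; apply: (wDl (wM (dP c dc).1 vcc)).
  apply: vgt_sum => i _; rewrite /bump /= add1n.
  apply: vgt_le (vgtM (high i c dc) (vge_eq (wX _ vcc))).
  by rewrite /= [_ *+ i.+2]mulrS; lra.
rewrite rc subr0 => vr2; have := ge c2; rewrite (vge_some _ vr2) /=; lra.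
Qed.

End Stability.

Lemma exprB_pchar (R : comNzRingType) p (x y : R) :
  p \in [pchar R] -> (x - y) ^+ p = x ^+ p - y ^+ p.
Proof. by move=> cp; rewrite -!(pFrobenius_autE cp) rmorphB. Qed.

Lemma exprD_pchar (R : comNzRingType) p (x y : R) :
  p \in [pchar R] -> (x + y) ^+ p = x ^+ p + y ^+ p.
Proof. by move=> cp; rewrite -!(pFrobenius_autE cp) rmorphD. Qed.

Lemma size_artin_schreier (R : nzRingType) (a : R) p :
  (1 < p)%N -> size ('X^p - 'X - a%:P) = p.+1.
Proof.
move=> p_gt1; rewrite -addrA size_polyDl size_polyXn // -opprD size_polyN.
rewrite (leq_ltn_trans (size_polyD _ _)) // size_polyX gtn_max ltnS p_gt1.
by rewrite (leq_ltn_trans (size_polyC_leq1 _)) // ltnS ltnW.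
Qed.

(** * Expansions in powers of P and the slopes they produce *)

Section Expansions.
Context (K M : fieldType) (v : valuation K ratG) (w : valuation M ratG).
Context (k : {rmorphism K -> M}) (x : M) (gam : K -> rat) (p : nat).
Hypotheses (p_char : p \in [pchar K]) (hv : henselian v setT).
Hypotheses (wk : forall c, w (k c) = v c).
Hypotheses (wx : forall c, w (x - k c) = Some (gam c)).
Hypotheses (gam_sup : forall d : rat, d < 0 -> exists c, d < gam c).
Hypotheses (gam_lt0 : forall c, gam c < 0).

Implicit Types (e r F Q : {poly K}) (c : K).

Let ev F : M := (map_poly k F).[x].

(** Stated for all centres rather than along a sequence, so that it serves every approximating
    sequence at once. *)
Definition near (A : K -> Prop) :=
  exists2 d : rat, d < 0 & forall c, d < gam c -> A c.

Lemma near_and (A B : K -> Prop) : near A -> near B -> near (fun c => A c /\ B c).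
Proof.
move=> [d d0 Ad] [e e0 Be]; exists (Num.max d e); first by rewrite gt_max d0.
by move=> c; rewrite gt_max => /andP[/Ad ? /Be ?].
Qed.

Lemma nearS (A B : K -> Prop) : (forall c, A c -> B c) -> near A -> near B.
Proof. by move=> AB [d d0 Ad]; exists d => // c /Ad /AB. Qed.

Lemma near_pos (l : rat) n : 0 < l -> near (fun c => 0 < l + gam c *+ n).
Proof.
move=> l0; have n0 : (0 : rat) < n.+1%:R by rewrite ltr0n.
exists (- (l / n.+1%:R)); first by rewrite oppr_lt0 divr_gt0.
move=> c; rewrite ltrNl ltr_pdivlMr // mulr_natr mulrS => lt_l.
have := gam_lt0 c; rewrite mulNrn in lt_l; lra.
Qed.

(** As [gam c] increases to 0 the constant terms decide. When they agree the slopes do, since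
    [gam c] is negative. *)
Lemma near_cmp (l1 l2 : rat) n1 n2 : n1 != n2 ->
  near (fun c => l1 + gam c *+ n1 < l2 + gam c *+ n2) \/
  near (fun c => l2 + gam c *+ n2 < l1 + gam c *+ n1).
Proof.
wlog lt_n : l1 l2 n1 n2 / (n1 < n2)%N => [wlog_lt|] n12.
  have := n12; rewrite neq_ltn => /orP[|] lt_n; first exact: wlog_lt.
  by rewrite or_comm; apply: wlog_lt => //; rewrite eq_sym.
have [l21|l12] := leP l2 l1.
  right; exists (-1) => // c _; have : gam c *+ n2 < gam c *+ n1 by rewrite ltr_nMn2l.
  lra.
have l0 : 0 < l2 - l1 by rewrite subr_gt0.
left; apply: nearS (near_pos n2 l0) => c.
have : gam c *+ n1 <= 0 by rewrite mulrn_wle0 // ltW.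
lra.
Qed.

Lemma near_add (y1 y2 : K -> M) (l1 l2 : rat) n1 n2 : n1 != n2 ->
  near (fun c => w (y1 c) = Some (l1 + gam c *+ n1 : rat)) ->
  near (fun c => w (y2 c) = Some (l2 + gam c *+ n2 : rat)) ->
  exists (l : rat) n, (n = n1 \/ n = n2) /\
    near (fun c => [/\ w (y1 c + y2 c) = Some (l + gam c *+ n : rat),
      l + gam c *+ n <= l1 + gam c *+ n1 & l + gam c *+ n <= l2 + gam c *+ n2]).
Proof.
move=> n12 near1 near2; have [lt12|lt21] := near_cmp l1 l2 n12.
  exists l1, n1; split; first by left.
  apply: nearS (near_and (near_and near1 near2) lt12) => c [[w1c w2c] lt12c].
  split=> //; last exact: ltW.
  by apply: wDl => //; rewrite (vgt_some _ w2c).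
exists l2, n2; split; first by right.
apply: nearS (near_and (near_and near1 near2) lt21) => c [[w1c w2c] lt12c].
split=> //; last exact: ltW.
by rewrite addrC; apply: wDl => //; rewrite (vgt_some _ w1c).
Qed.

Lemma horner_map_sub (r : {poly K}) c : ev r - k r.[c] =
  \sum_(i < (size r).-1) k r^`N(i.+1).[c] * (x - k c) ^+ i.+1.
Proof.
rewrite -horner_map /= taylor_sub size_map_poly; apply: eq_bigr => i _.
by rewrite nderivn_map horner_map.
Qed.

Let stable r := poly_stable p_char hv wk wx gam_sup gam_lt0 (r := r).

(** Besides its use for degrees, this approximates the values at [x] of polynomials of degree less
    than p by elements of [K], which is the source of immediacy. *)
Lemma stable_approx r : (size r <= p)%N -> r != 0 -> exists rho : rat,
  near (fun c => v r.[c] = Some rho /\ vgt w rho (ev r - k r.[c])).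
Proof.
move=> rp r0; have [d [rho [d0 dP]]] := stable rp r0.
exists rho, d => // c /dP[vr ri]; split=> //; rewrite horner_map_sub.
apply: vgt_sum => i _.
have := ri i; rewrite -(vgt_k wk) => rik.
apply: vgt_le (vgtM rik (vge_eq (wX _ (wx c)))).
by rewrite /= subrK.
Qed.

(** Once the constant term is subtracted, the stability of the derivative makes the linear Taylor
    term dominate. *)
Lemma small_degree_diff r : (1 < size r <= p)%N -> exists rho : rat,
  near (fun c => w (ev r - k r.[c]) = Some (rho + gam c *+ 1 : rat)).
Proof.
move=> rp; have dr0 := deriv_pchar_neq0 p_char rp; have /andP[r1 rp'] := rp.
have drp : (size r^`() <= p)%N.
  by rewrite (leq_trans _ rp') // ltnW // lt_size_deriv // -size_poly_gt0 ltnW.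
have [d [rho [d0 dP]]] := stable drp dr0.
exists rho, d => // c /dP[vr ri]; rewrite horner_map_sub.
case sz: (size r).-1 => [|m]; first by case: (size r) r1 sz => [|[|]].
rewrite big_ord_recl /= nderivn1 expr1.
apply: (wDl (wM (_ : w (k _) = Some rho) (wx c))); first by rewrite wk.
apply: vgt_sum => i _; rewrite /bump /= add1n.
have rik : vgt w (rho - gam c *+ i.+1) (k r^`N(i.+2).[c]).
  rewrite (vgt_k wk); have := ri i; rewrite nderivn_deriv hornerMn.
  have [ip|pi] := ltnP i.+2 p.
    by apply: (vgt_muln p_char); rewrite ip.
  move=> _; rewrite nderivn_poly0 ?horner0 ?vgt0 //.
  by rewrite (leq_trans _ pi) //; case/andP: rp.
apply: vgt_le (vgtM rik (vge_eq (wX _ (wx c)))).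
by rewrite /= [_ *+ i.+2]mulrS; lra.
Qed.

Variable a : K.
Let P : {poly K} := 'X^p - 'X - a%:P.
Hypothesis P_pos : vgt w 0 (ev P).

Let p_gt1 : (1 < p)%N. Proof. exact/prime_gt1/(pcharf_prime p_char). Qed.

Let size_P : size P = p.+1. Proof. exact: size_artin_schreier. Qed.

Let P0 : P != 0. Proof. by rewrite -size_poly_gt0 size_P. Qed.

Let M_char : p \in [pchar M]. Proof. by rewrite (fmorph_pchar k). Qed.

(** The polynomial X^p - X is additive. *)
Lemma artin_schreier_center c : ev P - k P.[c] = (x - k c) ^+ p - (x - k c).
Proof.
rewrite /ev /P !rmorphB /= map_polyXn map_polyX map_polyC !hornerE.
rewrite !rmorphB rmorphXn /= exprB_pchar //; ring.
Qed.

Lemma w_artin_schreier (y : M) (g : rat) :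
  w y = Some g -> g < 0 -> w (y ^+ p - y) = Some (g *+ p : rat).
Proof.
move=> wy g0; apply: (wDl (wX p wy)); rewrite vgtN (vgt_some _ wy).
case: (p) p_gt1 => [|[|q]] // _; rewrite /= mulrS.
have : g *+ q.+1 < 0 by rewrite mulrn_wlt0.
lra.
Qed.

Lemma v_P c : v P.[c] = Some (gam c *+ p : rat).
Proof.
rewrite -wk -[k _](subKr (ev P)) artin_schreier_center wBC.
apply: (wDl (w_artin_schreier (wx c) (gam_lt0 c))); rewrite vgtN.
by apply: vgt_le P_pos; rewrite /= mulrn_wle0 // ltW.
Qed.

Lemma evM F Q : ev (F * Q) = ev F * ev Q.
Proof. by rewrite /ev rmorphM hornerM. Qed.

Lemma evD F Q : ev (F + Q) = ev F + ev Q.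
Proof. by rewrite /ev rmorphD hornerD. Qed.

Let size_div F : F != 0 -> (size (F %/ P)%R < size F)%N.
Proof.
move=> F0; rewrite size_divp // size_P /=.
by rewrite ltn_subrL prime_gt0 ?(pcharf_prime p_char) // size_poly_gt0.
Qed.

Let size_mod F : (size (F %% P)%R <= p)%N.
Proof. by rewrite -ltnS -size_P ltn_modp. Qed.

(** Write F = QP + r. The factor [P] adds [p] to the slope of Q, and r has slope 0, so the two parts
    cannot cancel. For F(x) only a lower bound is kept, since P(x) has a larger value than P(c). *)
Lemma poly_value F : F != 0 -> exists (l : rat) n, (p %| n)%N /\
  near (fun c => v F.[c] = Some (l + gam c *+ n : rat)
                 /\ vge w (l + gam c *+ n : rat) (ev F)).
Proof.
move: {2}(size F).+1 (ltnSn (size F)) => m; elim: m F => // m IHm F Fm F0.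
have small r : (size r <= p)%N -> r != 0 -> exists (l : rat), 
    near (fun c => v r.[c] = Some (l + gam c *+ 0 : rat)
                 /\ vge w (l + gam c *+ 0 : rat) (ev r)).
  move=> rp r0; have [l near_l] := stable_approx rp r0.
  exists l; apply: nearS near_l => c [vr wr]; rewrite addr0; split=> //.
  rewrite -(subrK (k r.[c]) (ev r)); apply: vgeD; first exact: vgtW.
  by rewrite (vge_k wk) vge_eq.
have FE := divp_eq F P; set Q := F %/ P in FE; set r := F %% P in FE.
have [Q0|Q0] := eqVneq Q 0.
  have Fr : F = r by rewrite FE Q0 mul0r add0r.
  have Fp : (size F <= p)%N by rewrite Fr; exact: size_mod.
  have [l near_l] := small F Fp F0.
  by exists l, 0%N; split; first exact: dvdn0.
have [|l [n [pn near_l]]] := IHm Q _ Q0.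
  by rewrite (leq_trans (size_div F0)).
have near_QP : near (fun c => v (Q * P).[c] = Some (l + gam c *+ (n + p) : rat)
                 /\ vge w (l + gam c *+ (n + p) : rat) (ev (Q * P))).
  apply: nearS near_l => c [vQ wQ]; rewrite hornerM evM mulrnDr addrA; split.
    exact: wM vQ (v_P c).
  apply: vgeM wQ _; apply/vgtW/(vgt_le _ P_pos).
  by rewrite /= mulrn_wle0 // ltW.
have pnp : (p %| n + p)%N by rewrite dvdn_addr.
have [r0|r0] := eqVneq r 0.
  by exists l, (n + p)%N; split=> //; rewrite FE r0 addr0.
have [l' near_r] := small r (size_mod F) r0.
have [|||l'' [n' [n'E near_s]]] := @near_add (fun c => k (Q * P).[c]) (fun c => k r.[c])
  l l' (n + p)%N 0%N.
- by have := prime_gt0 (pcharf_prime p_char); lia.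
- by apply: nearS near_QP => c []; rewrite wk.
- by apply: nearS near_r => c []; rewrite wk.
exists l'', n'; split; first by case: n'E => ->.
apply: nearS (near_and near_s (near_and near_QP near_r)) => c [[ws le1 le2] [[_ wQP] [_ wr]]].
rewrite FE hornerD evD -wk rmorphD; split=> //.
by apply: vgeD; [apply: vge_le wQP | apply: vge_le wr].
Qed.

(** In F = QP + r the value of Q(x)P(x) exceeds that of Q(c)P(c), which therefore gives its part of
    the difference the slope n + p. The remainder contributes slope 1, or nothing when it is
    constant. *)
Lemma poly_diff F : (1 < size F)%N -> exists (l : rat) n,
  (n = 1%N \/ (0 < n)%N && (p %| n)%N) /\
  near (fun c => w (ev F - k F.[c]) = Some (l + gam c *+ n : rat)).
Proof.
move=> F1; have FE := divp_eq F P; set Q := F %/ P in FE; set r := F %% P in FE.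
have F0 : F != 0 by rewrite -size_poly_gt0 ltnW.
have [Q0|Q0] := eqVneq Q 0.
  have Fr : F = r by rewrite FE Q0 mul0r add0r.
  have [|l near_l] := @small_degree_diff F; first by rewrite F1 Fr size_mod.
  by exists l, 1%N; split; first by left.
have [l [n [pn near_l]]] := poly_value Q0.
have near_QP : near (fun c => w (ev (Q * P) - k (Q * P).[c])
                              = Some (l + gam c *+ (n + p) : rat)).
  apply: nearS near_l => c [vQ wQ]; rewrite wBC.
  rewrite hornerM evM mulrnDr addrA; apply: wDl.
    by rewrite wk; exact: wM vQ (v_P c).
  rewrite vgtN mulrC addrC; apply: vgtM wQ; apply: vgt_le P_pos.
  by rewrite /= mulrn_wle0 // ltW.
have np : (0 < n + p)%N && (p %| n + p)%N.
  by rewrite dvdn_add // addn_gt0 (ltnW p_gt1) orbT.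
have [r1|r1] := leqP (size r) 1.
  exists l, (n + p)%N; split; first by right.
  apply: nearS near_QP => c <-; congr (w _).
  rewrite FE evD hornerD rmorphD (size1_polyC r1) /= /ev map_polyC !hornerC /=; ring.
have [|l' near_r] := @small_degree_diff r; first by rewrite r1 size_mod.
have [|l'' [n' [n'E near_s]]] := @near_add (fun c => ev (Q * P) - k (Q * P).[c])
  (fun c => ev r - k r.[c]) l l' (n + p)%N 1%N _ near_QP near_r.
  apply/negP => /eqP np1; move: np; rewrite np1 dvdn1 => /eqP p1.
  by move: p_gt1; rewrite p1.
exists l'', n'; split; first by case: n'E => ->; [right | left].
apply: nearS near_s => c [<- _ _]; congr (w _).
rewrite FE evD hornerD rmorphD /=; ring.
Qed.

Hypothesis p_odd : odd p.

Lemma square_diff c : w (ev (P ^+ 2) - k (P ^+ 2).[c]) = Some (gam c *+ (p + p) : rat).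
Proof.
have vP2 : v (P ^+ 2).[c] = Some (gam c *+ (p + p) : rat).
  by rewrite horner_exp mulrnDr expr2; exact: wM (v_P c) (v_P c).
rewrite wBC; apply: wDl; first by rewrite wk.
rewrite vgtN expr2 evM; apply: vgt_le (vgtM P_pos (vgtW P_pos)).
by rewrite /= addr0 mulrn_wle0 // ltW.
Qed.

(** Every polynomial congruent to the example modulo the Artin-Schreier image has this form; the
    example itself is the case e = -X^2. *)
Let as_poly e : {poly K} := P ^+ 2 + (e ^+ p - e).

Lemma as_poly_diff e c : let E := ev e - k e.[c] in
  ev (as_poly e) - k (as_poly e).[c] =
  (ev (P ^+ 2) - k (P ^+ 2).[c]) + (E ^+ p - E).
Proof.
move=> E; rewrite /E (exprB_pchar _ _ M_char) /ev /as_poly; move: (P) => Q.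
rewrite !(rmorphD, rmorphN, rmorphXn) /= !(hornerD, hornerN, horner_exp).
rewrite !(rmorphD, rmorphN, rmorphXn) /=; ring.
Qed.

(** Let E = e(x) - e(c). If [l > 0], then E has positive value near x and P^2 decides. If [l <= 0],
    its value is negative, E^p dominates E, and the slopes np and 2p could agree only for n = 2,
    which is neither 1 nor a multiple of an odd prime. *)
Lemma as_poly_degree e : exists (l : rat) n, (p <= n)%N /\
  near (fun c => w (ev (as_poly e) - k (as_poly e).[c]) = Some (l + gam c *+ n : rat)).
Proof.
have near2 : near (fun c => w (ev (P ^+ 2) - k (P ^+ 2).[c])
                            = Some (0 + gam c *+ (p + p) : rat)).
  by exists (-1) => // c _; rewrite square_diff add0r.
have [e1|e1] := leqP (size e) 1.
  exists 0, (p + p)%N; split; first exact: leq_addr.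
  apply: nearS near2 => c <-; rewrite as_poly_diff (size1_polyC e1) /ev map_polyC.
  by rewrite !hornerC subrr expr0n -[p == 0]negbK -lt0n (ltnW p_gt1) subrr addr0.
have [l [n [nE near_e]]] := poly_diff e1.
have [l0|l0] := leP l 0; last first.
  exists 0, (p + p)%N; split; first exact: leq_addr.
  apply: nearS (near_and near2 (near_and near_e (near_pos n l0))) => c [w2 [we e0]].
  rewrite as_poly_diff; apply: (wDl w2).
  have E_pos : vgt w 0 ((ev e - k e.[c]) ^+ p - (ev e - k e.[c])).
    apply: vgtB; last by rewrite (vgt_some _ we).
    by rewrite (vgt_some _ (wX p we)) /= mulrn_wgt0 // ltnW.
  by apply: vgt_le E_pos; rewrite /= add0r mulrn_wle0 // ltW.
have n_gt0 : (0 < n)%N by case: nE => [->|/andP[]].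
have near_ep : near (fun c => w ((ev e - k e.[c]) ^+ p - (ev e - k e.[c]))
                              = Some (l *+ p + gam c *+ (n * p) : rat)).
  apply: nearS near_e => c we; rewrite mulrnA -mulrnDl; apply: (w_artin_schreier we).
  have := mulrn_wlt0 n (gam_lt0 c); rewrite n_gt0; lra.
have [|l' [n' [n'E near_s]]] := near_add _ near2 near_ep.
  rewrite addnn -mul2n eqn_pmul2r ?(ltnW p_gt1) //; apply/negP => /eqP n2.
  case: nE => [n1|]; first by rewrite n1 in n2.
  rewrite -n2 => /andP[_]; rewrite dvdn_prime2 ?(pcharf_prime p_char) // => /eqP p2.
  by move: p_odd; rewrite p2.
exists l', n'; split.
  by case: n'E => ->; [exact: leq_addr | exact: leq_pmull].
by apply: nearS near_s => c []; rewrite as_poly_diff.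
Qed.

(** Here x^2 - c^2 = (2x - (x - c)) (x - c), and 2 is a unit as p is odd. For c closer to x than 0
    the first factor has value [gam 0], and p (gam 0 + gam c) < 2p gam c. *)
Lemma as_poly_degree_p : near (fun c =>
  w (ev (as_poly (- 'X^2)) - k (as_poly (- 'X^2)).[c])
  = Some (gam 0 *+ p + gam c *+ p : rat)).
Proof.
exists (gam 0) => // c lt_c; rewrite as_poly_diff.
have w_x : w x = Some (gam 0) by rewrite -(wx 0) rmorph0 subr0.
have p_gt2 : (2 < p)%N by case: (p) p_gt1 p_odd => [|[|[|q]]].
have w2 : w 2%:R = Some 0 by rewrite -(rmorph_nat k) wk (v_natr v p_char).
set E := ev (- 'X^2) - k _.
have wE : w E = Some (gam 0 + gam c : rat).
  have -> : E = - ((2%:R * x - (x - k c)) * (x - k c)).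
    by rewrite /E /ev !(rmorphN, rmorphXn) /= map_polyX !hornerE !(rmorphN, rmorphXn) /=; ring.
  rewrite wN; apply: wM (wx c); apply: wDl; first by rewrite (wM w2 w_x) add0r.
  by rewrite vgtN (vgt_some _ (wx c)).
have E_lt0 : gam 0 + gam c < 0 by have := gam_lt0 0; have := gam_lt0 c; lra.
rewrite addrC -mulrnDl; apply: (wDl (w_artin_schreier wE E_lt0)).
rewrite (vgt_some _ (square_diff c)) /= mulrnDl mulrnDr ltrD2r.
by rewrite ltr_pMn2r // ltnW.
Qed.

End Expansions.

Definition const_rmorphism (K : fieldType) : {rmorphism K -> ratfun K} :=
  @FracField.tofrac {poly K} \o @polyC K.

(** Brings K(X) into the setting of a point [x] with its evaluation map. *)
Lemma rat_polyE (K : fieldType) (F : {poly K}) :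
  rat_poly F = (map_poly (const_rmorphism K) F).[rat_poly 'X].
Proof.
rewrite horner_coef size_map_poly -{1}[F]coefK poly_def /rat_poly rmorph_sum.
apply: eq_bigr => i _; rewrite coef_map -mul_polyC rmorphM rmorphXn /=; congr (_ * _).
Qed.

Lemma rat_poly_eq0 (K : fieldType) (Q : {poly K}) : (rat_poly Q == 0) = (Q == 0).
Proof. exact: tofrac_eq0. Qed.

Lemma rat_polyM (K : fieldType) (P Q : {poly K}) : rat_poly (P * Q) = rat_poly P * rat_poly Q.
Proof. exact: rmorphM. Qed.

Lemma rat_polyD (K : fieldType) (P Q : {poly K}) : rat_poly (P + Q) = rat_poly P + rat_poly Q.
Proof. exact: rmorphD. Qed.

Lemma rat_polyB (K : fieldType) (P Q : {poly K}) : rat_poly (P - Q) = rat_poly P - rat_poly Q.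
Proof. exact: rmorphB. Qed.

Lemma rat_polyXn (K : fieldType) (P : {poly K}) n : rat_poly (P ^+ n) = rat_poly P ^+ n.
Proof. exact: rmorphXn. Qed.

Lemma rat_const0 (K : fieldType) : rat_const (0 : K) = 0.
Proof. exact: (rmorph0 (const_rmorphism K)). Qed.

Lemma rat_constB (K : fieldType) (a b : K) : rat_const (a - b) = rat_const a - rat_const b.
Proof. exact: (rmorphB (const_rmorphism K)). Qed.

Lemma rat_constM (K : fieldType) (a b : K) : rat_const (a * b) = rat_const a * rat_const b.
Proof. exact: (rmorphM (const_rmorphism K)). Qed.

Lemma rat_constV (K : fieldType) (a : K) : rat_const a^-1 = (rat_const a)^-1.
Proof. exact: (fmorphV (const_rmorphism K)). Qed.

(** * From centres near X to approximating sequences *)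

Section Approximation.
Context (K : fieldType) (v : valuation K ratG) (w : valuation (ratfun K) ratG).
Context (gam : K -> rat).
Hypotheses (wk : forall c, w (rat_const c) = v c).
Hypotheses (wx : forall c, w (rat_poly 'X - rat_const c) = Some (gam c)).
Hypotheses (gam_sup : forall d : rat, d < 0 -> exists c, d < gam c).
Hypotheses (gam_lt0 : forall c, gam c < 0).
Hypothesis wv : forall y g, w y = Some g -> exists c, v c = Some g.

Section Sequence.
Context (d : Order.disp_t) (I : orderType d) (z : I -> K).

(** Limits of a sequence are tested on successors only, so these have to exist. *)
Lemma limit_successor (i : I) : limit_ordinal I -> exists j, successor i j.
Proof.
move=> [_ wf lim]; have [j ij] := lim i.
elim/(well_founded_ind wf): j ij => j IHj ij.
have [[m [im mj]]|nm] := pselect (exists m, (i < m)%O /\ (m < j)%O); first exact: IHj mj im.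
exists j; split=> // m im; rewrite leNgt; apply/negP => mj; apply: nm.
by exists m.
Qed.

Hypothesis zP : approximating v w z.

Lemma gam_center i j : successor i j -> v (z i - z j) = Some (gam (z i)).
Proof.
by move=> ij; have [_ _ _ /(_ i j ij) zij] := zP; rewrite -wk rat_constB -zij; exact: wx.
Qed.

Lemma gam_increasing i j : (i < j)%O -> gam (z i) < gam (z j).
Proof.
move=> ij; have [lim pc _ _] := zP.
have [i' ii'] := limit_successor i lim; have [j' jj'] := limit_successor j lim.
have lt_some (g h : rat) : vlt (G := ratG) (Some g) (Some h) -> g < h.
  by rewrite /vlt /= -ltNge.
apply: lt_some; rewrite -(gam_center ii') -(gam_center jj').
have := ii'.2 j ij; rewrite le_eqVlt => /orP[/eqP ->|i'j]; first exact: pc ij jj'.1.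
have := pc _ _ _ ii'.1 i'j; have := pc _ _ _ i'j jj'.1.
rewrite (gam_center ii') (gam_center jj'); case: (v _) => // g.
by rewrite /vlt /= -!ltNge => lt1 lt2; exact: lt_trans lt1.
Qed.

(** If the distances [gam (z i)] all stayed below some [gam c], then [c] would be a limit of the
    sequence in [K]. *)
Lemma near_sequence (A : K -> Prop) : near gam A -> exists i0, forall i, (i0 < i)%O -> A (z i).
Proof.
move=> [e e0 Ae]; have [c ec] := gam_sup e0.
have [i gi] : exists i, e < gam (z i).
  apply: contrapT => nex; have [_ _ nlim _] := zP; apply: nlim; exists c => i j ij.
  rewrite (gam_center ij) -wk rat_constB.
  have -> : rat_const c - rat_const (z i)
      = (rat_poly 'X - rat_const (z i)) - (rat_poly 'X - rat_const c) by ring.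
  apply: wDl => //; rewrite vgtN (vgt_some _ (wx c)).
  have [//|le_c] := ltP (gam (z i)) (gam c).
  by exfalso; apply: nex; exists i; exact: lt_le_trans ec le_c.
by exists i => j ij; apply: Ae; exact: lt_trans (gam_increasing ij).
Qed.

Lemma near_approx_degree F (l : rat) n : (0 < n)%N ->
  near gam (fun c => w (rat_poly F - rat_const F.[c]) = Some (l + gam c *+ n : rat)) ->
  approx_degree v w z F n.
Proof.
move=> n0 nearF; split=> //; have [i0 i0P] := near_sequence nearF.
have [[i] _ lim] : limit_ordinal I by case: zP.
exists i0, l; split; last by move=> j /i0P ->; rewrite wx.
(* One centre suffices to see that [l] is a value of [K]: it is w(F - F(c)) - n w(X - c), and every
   value of K(X) is a value of [K]. *)
have [j /i0P wj] := lim i0.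
have [c vc] := wv wj; have [b vb] := wv (wx (z j)).
exists (c / b ^+ n) => //.
by rewrite (wM vc (wV (wX n vb))) /= addrK.
Qed.

End Sequence.
End Approximation.

(** * The t-adic valuation of an algebraic closure of F_p(t) *)

Section ValuationRing.
Context (F : fieldType) (R : set F) (t : F).

Definition is_subring (A : set F) : Prop :=
  [/\ A 1, forall x y, A x -> A y -> A (x - y)
    & forall x y, A x -> A y -> A (x * y)].

Section SubringTheory.
Variables (A : set F) (sA : is_subring A).

Lemma subring1 : A 1. Proof. by case: sA. Qed.
Lemma subringB x y : A x -> A y -> A (x - y). Proof. by case: sA => _ + _; apply. Qed.
Lemma subringM x y : A x -> A y -> A (x * y). Proof. by case: sA => _ _; apply. Qed.
Lemma subring0 : A 0. Proof. by rewrite -(subrr 1); exact: subringB subring1 subring1. Qed.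
Lemma subringN x : A x -> A (- x).
Proof. by move=> Ax; rewrite -sub0r; exact: subringB subring0 Ax. Qed.
Lemma subringD x y : A x -> A y -> A (x + y).
Proof. by move=> Ax Ay; rewrite -[y]opprK; exact/subringB/subringN. Qed.
Lemma subringX n x : A x -> A (x ^+ n).
Proof.
move=> Ax; elim: n => [|n IHn]; first exact: subring1.
by rewrite exprS; exact: subringM.
Qed.
Lemma subring_sum (I : Type) (r : seq I) (P : pred I) (f : I -> F) :
  (forall i, P i -> A (f i)) -> A (\sum_(i <- r | P i) f i).
Proof.
by move=> Af; apply: (big_ind A) => //; [exact: subring0 | exact: subringD].
Qed.

Definition coefs_in (q : {poly F}) := forall i, A q`_i.

Lemma coefs_inC c : A c -> coefs_in c%:P.
Proof. by move=> Ac [|i]; rewrite coefC //=; exact: subring0. Qed.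
Lemma coefs_inX : coefs_in 'X.
Proof. by move=> i; rewrite coefX; case: eqP => _; [exact: subring1 | exact: subring0]. Qed.
Lemma coefs_inB q r : coefs_in q -> coefs_in r -> coefs_in (q - r).
Proof. by move=> Aq Ar i; rewrite coefB; exact: subringB. Qed.
Lemma coefs_inM q r : coefs_in q -> coefs_in r -> coefs_in (q * r).
Proof.
by move=> Aq Ar i; rewrite coefM; apply: subring_sum => j _; exact: subringM.
Qed.

Definition adjoin x : set F := [set q.[x] | q in coefs_in].

Lemma adjoin_subring x : is_subring (adjoin x).
Proof.
split.
- by exists 1; rewrite ?hornerC //; exact: coefs_inC subring1.
- by move=> _ _ [q Aq <-] [r Ar <-]; exists (q - r); rewrite ?hornerE //; exact: coefs_inB.
- by move=> _ _ [q Aq <-] [r Ar <-]; exists (q * r); rewrite ?hornerM //; exact: coefs_inM.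
Qed.

Lemma sub_adjoin x : A `<=` adjoin x.
Proof. by move=> c Ac; exists c%:P; rewrite ?hornerC //; exact: coefs_inC. Qed.

Lemma mem_adjoin x : adjoin x x.
Proof. by exists 'X; rewrite ?hornerX //; exact: coefs_inX. Qed.

End SubringTheory.

Hypotheses (sR : is_subring R) (Rt : R t) (nRt : ~ R t^-1).

Let t0 : t != 0.
Proof. by apply/eqP => t0; apply: nRt; rewrite t0 invr0; exact: subring0. Qed.

(** Chevalley's construction: a subring that is maximal under these conditions turns out to be a
    valuation ring. *)
Lemma maximal_subring : exists A, [/\ is_subring A, R `<=` A, ~ A t^-1
  & forall B, is_subring B -> A `<=` B -> ~ B t^-1 -> B `<=` A].
Proof.
pose good (A : set F) := [/\ is_subring A, R `<=` A & ~ A t^-1].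
have [|A [PA Amax]] := @Zorn_bigcup F (fun A => A = set0 \/ good A).
  move=> C CP Ctot.
  have [[B CB gB]|nC] := pselect (exists2 B, C B & good B); last first.
    left; apply/seteqP; split=> // x [B CB Bx].
    have [B0|gB] := CP B CB; first by rewrite B0 in Bx.
    by apply: nC; exists B.
  have up x y : (\bigcup_(X in C) X) x -> (\bigcup_(X in C) X) y ->
      exists B', [/\ C B', good B', B' x & B' y].
    have gC X z : C X -> X z -> good X.
      by move=> CX Xz; have [X0|//] := CP X CX; rewrite X0 in Xz.
    move=> [X CX Xx] [Y CY Yy].
    have [XY|YX] := Ctot X Y CX CY.
      by exists Y; split=> //; [exact: gC Yy | exact: XY].
    by exists X; split=> //; [exact: gC Xx | exact: YX].
  have [sB RB _] := gB.
  right; split.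
  - split; first by exists B => //; exact: subring1.
    + move=> x y Ux Uy; have [B' [CB' [sB' _ _] Bx By]] := up x y Ux Uy.
      by exists B' => //; exact: subringB.
    + move=> x y Ux Uy; have [B' [CB' [sB' _ _] Bx By]] := up x y Ux Uy.
      by exists B' => //; exact: subringM.
  - by move=> x Rx; exists B => //; exact: RB.
  - by move=> Ut; have [B' [_ [_ _ nB'] Bt _]] := up _ _ Ut Ut.
have [A0|[sA RA nA]] := PA.
  exfalso; apply: (Amax R); last by right; split.
  by rewrite A0; split=> // /(_ 1 (subring1 sR)).
exists A; split=> // B sB AB nB x Bx; apply: contrapT => nAx.
apply: (Amax B); first by split=> // /(_ x Bx).
by right; split=> //; exact: subset_trans AB.
Qed.

Section Maximal.
Variable A : set F.
Hypotheses (sA : is_subring A) (RA : R `<=` A) (nAt : ~ A t^-1).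
Hypothesis Amax : forall B, is_subring B -> A `<=` B -> ~ B t^-1 -> B `<=` A.

Let At : A t. Proof. exact: RA. Qed.

Lemma adjoin_inv x : ~ A x -> exists2 q, coefs_in A q & q.[x] = t^-1.
Proof.
move=> nAx; apply: contrapT => nt; apply: nAx.
apply: (Amax (adjoin_subring sA x) (sub_adjoin sA x) _ (mem_adjoin sA x)).
by move=> [q Aq qx]; apply: nt; exists q.
Qed.

Lemma one_sub_neq0 a : A a -> 1 - t * a != 0.
Proof.
move=> Aa; apply/eqP => /subr0_eq ta; apply: nAt.
by rewrite (_ : t^-1 = a) //; apply: (mulfI t0); rewrite divff.
Qed.

(** If u = 1 - ta had no inverse in [A], maximality would give 1/t = q(1/u), so that u^n = tc with c
    in [A]. But u^n is 1 modulo t, so 1/t would lie in [A]. *)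
Lemma one_sub_inv a : A a -> A (1 - t * a)^-1.
Proof.
move=> Aa; apply: contrapT => nu; have [q Aq qu] := adjoin_inv nu.
have u0 := one_sub_neq0 Aa; set u := 1 - t * a in nu qu u0.
pose n := size q.
have Au : A u by apply: subringB => //; [exact: subring1 | exact: subringM].
pose c := \sum_(i < n) q`_i * u ^+ (n - i).
have Ac : A c by apply: subring_sum => // i _; apply: subringM => //; exact: subringX.
have uc : u ^+ n = t * c.
  rewrite -[LHS](mulVKf t0) -qu horner_coef; congr (_ * _).
  rewrite big_distrl /=; apply: eq_bigr => i _.
  by rewrite -mulrA; congr (_ * _); rewrite exprVn mulrC -expfB_cond ?(negPf u0) ?add0n //= ltnW.
have [a' Aa' ua'] : exists2 a', A a' & u ^+ n = 1 - t * a'.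
  elim: (n) => [|m [b Ab IHm]]; first by exists 0; [exact: subring0 | rewrite mulr0 subr0].
  exists (b + a - t * a * b).
    by apply: subringB => //; [exact: subringD | do 2?apply: subringM].
  by rewrite exprS IHm /u; ring.
apply: nAt; rewrite (_ : t^-1 = c + a'); first exact: subringD.
by apply: (mulfI t0); rewrite divff // mulrDr -uc ua' subrK.
Qed.

(** If neither element lies in [A], maximality gives 1/t = q(x) = r(1/x). The relation of smaller
    degree becomes monic on inverting 1 - t r_0, and then lowers the degree of the other one: an
    infinite descent. *)
Lemma valuation_ringP x : A x \/ A x^-1.
Proof.
apply: contrapT => /not_orP[nx nV].
have [q Aq qx] := adjoin_inv nx; have [r Ar rx] := adjoin_inv nV.
move: {2}(size q + size r)%N.+1 (ltnSn (size q + size r)%N) => N.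
elim: N x nx nV q r Aq Ar qx rx => // N IHN x nx nV q r Aq Ar qx rx.
wlog le_rq : x q r nx nV Aq Ar qx rx / (size r <= size q)%N => [wlog_le|] leN.
  have [|/ltnW le_qr] := leqP (size r) (size q); first by move=> ?; apply: (wlog_le x q r).
  by apply: (wlog_le x^-1 r q) => //; rewrite ?invrK // addnC.
have x0 : x != 0 by apply/eqP => x0; apply: nx; rewrite x0; exact: subring0.
have [m szr] : exists m, size r = m.+2.
  have: (1 < size r)%N.
    rewrite ltnNge; apply/negP => /size1_polyC rC; apply: nAt.
    by rewrite -rx rC hornerC; exact: Ar.
  by case: (size r) => [|[|m]] // _; exists m.
have [n szq] : exists n, size q = n.+2 by case: (size q) le_rq => [|[|n]]; rewrite szr //; exists n.
have mn : (m <= n)%N by rewrite szq szr in le_rq.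
pose u := (1 - t * r`_0)^-1; have Au : A u by exact: one_sub_inv.
(* Multiplying t r(1/x) = 1 by x^(n+1) and inverting 1 - t r_0 writes x^(n+1) in lower powers of
   x. *)
pose s := \sum_(j < m.+1) (t * u * r`_j.+1) *: 'X^(n - j).
have xn : x ^+ n.+1 = s.[x].
  have r1 : 1 - t * r`_0 = t * \sum_(j < m.+1) r`_j.+1 * x^-1 ^+ j.+1.
    rewrite -(divff t0) -mulrBr -rx horner_coef szr big_ord_recl /= expr0 mulr1.
    by rewrite addrAC subrr add0r.
  have -> : x ^+ n.+1 = u * (1 - t * r`_0) * x ^+ n.+1.
    by rewrite mulVf ?mul1r // one_sub_neq0.
  rewrite r1 horner_sum mulrA [u * t]mulrC mulr_sumr mulr_suml; apply: eq_bigr => j _.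
  rewrite hornerZ hornerXn !mulrA -!mulrA; do 3 congr (_ * _).
  rewrite exprVn mulrC -expfB_cond ?(negPf x0) ?add0n ?subSS //.
  by rewrite ltnS (leq_trans (leq_ord j)).
have As : coefs_in A s.
  move=> i; rewrite coef_sum; apply: subring_sum => // j _.
  rewrite coefZ coefXn; apply: subringM => //; first by do 2?apply: subringM.
  by case: eqP => _; [exact: subring1 | exact: subring0].
have szs : (size s <= n.+1)%N.
  apply: (leq_trans (size_sum _ _ _)); apply/bigmax_leqP => j _.
  by apply: (leq_trans (size_scale_leq _ _)); rewrite size_polyXn ltnS leq_subr.
pose q' := q - (q`_n.+1)%:P * ('X^(n.+1) - s).
have Aq' : coefs_in A q'.
  apply: coefs_inB => //; apply: coefs_inM => //; first exact: coefs_inC.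
  apply: coefs_inB => // i; rewrite coefXn.
  by case: eqP => _; [exact: subring1 | exact: subring0].
apply: (IHN x nx nV q' r) => //.
  by rewrite /q' !hornerE -xn subrr mulr0 subr0.
rewrite -ltnS; apply: leq_trans leN; rewrite ltnS ltn_add2r szq ltnS.
apply/leq_sizeP => i ni; rewrite coefB coefCM coefB coefXn.
have -> : s`_i = 0 by apply/(leq_sizeP _ n.+1).
rewrite subr0; move: ni; rewrite leq_eqVlt => /orP[/eqP <-|ni].
  by rewrite eqxx mulr1 subrr.
by rewrite gtn_eqF // mulr0 subr0 nth_default // szq.
Qed.

End Maximal.
End ValuationRing.

(** * The rational-valued valuation attached to the valuation ring *)

Section RationalValuation.
Context {F : fieldType} (R A : set F) (t : F).
Hypotheses (sA : is_subring A) (RA : R `<=` A) (t0 : t != 0) (At : A t) (nAt : ~ A t^-1).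
Hypothesis AP : forall x, A x \/ A x^-1.

Implicit Types x y f : F.

Let U x := [/\ x != 0, A x & A x^-1].

Hypothesis R_tX : forall f, R f -> f != 0 -> exists n u, U u /\ f = t ^+ n * u.
Hypothesis R_alg : forall x, exists q, [/\ q != 0, coefs_in R q & root q x].

Let U1 : U 1. Proof. by split; rewrite ?oner_neq0 ?invr1 //; exact: subring1. Qed.

Let UM x y : U x -> U y -> U (x * y).
Proof.
move=> [x0 Ax Ax'] [y0 Ay Ay']; split; first by rewrite mulf_neq0.
  exact: subringM.
by rewrite invfM; exact: subringM.
Qed.

Let UV x : U x -> U x^-1.
Proof. by move=> [x0 Ax Ax']; split; rewrite ?invr_eq0 ?invrK. Qed.

Let UX x n : U x -> U (x ^+ n).
Proof. by move=> Ux; elim: n => // n IHn; rewrite exprS; exact: UM. Qed.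

Let tX0 n : t ^+ n != 0. Proof. exact: expf_neq0. Qed.

(** Valuation rings are integrally closed. *)
Lemma A_root x n : (0 < n)%N -> A (x ^+ n) -> A x.
Proof.
case: n => // n _ Axn; have [//|AV] := AP x.
have [->|x0] := eqVneq x 0; first exact: subring0.
rewrite (_ : x = x ^+ n.+1 * x^-1 ^+ n); last by rewrite exprS exprVn mulfK ?expf_neq0.
by apply: subringM => //; exact: subringX.
Qed.

Lemma A_tdiv a b : A (t ^+ b / t ^+ a) -> (a <= b)%N.
Proof.
move=> Ab; rewrite leqNgt; apply/negP => lt_ba; apply: nAt.
rewrite (_ : t^-1 = t ^+ b / t ^+ a * t ^+ (a - b).-1).
  by apply: subringM => //; exact: subringX.
have {1}-> : a = (b + ((a - b).-1 + 1))%N by rewrite addn1 prednK ?subn_gt0 // subnKC // ltnW.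
by rewrite !exprD expr1; field; rewrite t0 !tX0.
Qed.

Lemma U_tdiv a b : U (t ^+ b / t ^+ a) -> a = b.
Proof.
move=> [_ Aab]; rewrite invf_div => Aba.
by apply/eqP; rewrite eqn_leq (A_tdiv Aab) (A_tdiv Aba).
Qed.

(** Some power of [x] is a unit times an integral power of [t]; the two natural exponents stand for
    the integer b - a. *)
Definition has_value x (r : rat) := exists m a b,
  [/\ (0 < m)%N, U (x ^+ m * t ^+ a / t ^+ b) & r = (b%:R - a%:R) / m%:R].

Lemma has_value_uniq x r s : has_value x r -> has_value x s -> r = s.
Proof.
move=> [m [a [b [m0 Ux ->]]]] [m' [a' [b' [m'0 Ux' ->]]]].
have xm0 n : x ^+ n != 0.
  apply: expf_neq0; apply/eqP => x0; case: Ux.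
  by rewrite x0 expr0n -[m == 0]negbK -lt0n m0 /= !mul0r eqxx.
have /U_tdiv E : U (t ^+ (a * m' + b' * m) / t ^+ (a' * m + b * m')).
  rewrite (_ : _ / _ = (x ^+ m * t ^+ a / t ^+ b) ^+ m' *
    (x ^+ m' * t ^+ a' / t ^+ b')^-1 ^+ m).
    by apply: UM; apply: UX => //; exact: UV.
  rewrite !exprD !exprM exprVn !exprMn !exprVn -!exprM [(m' * m)%N]mulnC.
  by field; rewrite !tX0 xm0.
have mr : m%:R != 0 :> rat by rewrite pnatr_eq0 -lt0n.
have mr' : m'%:R != 0 :> rat by rewrite pnatr_eq0 -lt0n.
have /(congr1 (fun n => n%:R : rat)) := E; rewrite !natrD !natrM => ER.
apply: (mulIf mr); rewrite divfK // mulrAC; apply: (mulIf mr'); rewrite divfK //.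
move: ER; lra.
Qed.

Lemma has_valueM x y r s : has_value x r -> has_value y s -> has_value (x * y) (r + s).
Proof.
move=> [m [a [b [m0 Ux ->]]]] [m' [a' [b' [m'0 Uy ->]]]].
exists (m * m')%N, (a * m' + a' * m)%N, (b * m' + b' * m)%N; split.
- by rewrite muln_gt0 m0.
- rewrite (_ : _ / _ = (x ^+ m * t ^+ a / t ^+ b) ^+ m' *
    (y ^+ m' * t ^+ a' / t ^+ b') ^+ m); first by apply: UM; exact: UX.
  rewrite exprMn !exprD !exprM !exprMn !exprVn -!exprM [(m' * m)%N]mulnC.
  by field; rewrite !tX0.
have mr : m%:R != 0 :> rat by rewrite pnatr_eq0 -lt0n.
have mr' : m'%:R != 0 :> rat by rewrite pnatr_eq0 -lt0n.
by rewrite !natrD !natrM; field; rewrite mr mr'.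
Qed.

Lemma has_value_tX n u : U u -> has_value (t ^+ n * u) n%:R.
Proof.
move=> Uu; exists 1%N, 0%N, n; split=> //; last by rewrite subr0 divr1.
by rewrite expr1 expr0 mulr1 mulrAC divff // mul1r.
Qed.

Lemma has_value_ge0 x r : has_value x r -> (0 <= r <-> A x).
Proof.
move=> [m [a [b [m0 Ux ->]]]]; have mr : 0 < m%:R :> rat by rewrite ltr0n.
rewrite pmulr_lge0 ?invr_gt0 // subr_ge0 ler_nat.
have x0 : x != 0.
  apply/eqP => x0; case: Ux.
  by rewrite x0 expr0n -[m == 0]negbK -lt0n m0 /= !mul0r eqxx.
have [_ Axm Axm'] := Ux; split=> [ab|Ax].
  apply: (A_root m0).
  rewrite (_ : x ^+ m = x ^+ m * t ^+ a / t ^+ b * t ^+ (b - a)).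
    by apply: subringM => //; exact: subringX.
  have {1}-> : b = (a + (b - a))%N by rewrite subnKC.
  by rewrite exprD; field; rewrite !tX0.
apply: A_tdiv.
rewrite (_ : _ / _ = x ^+ m * (x ^+ m * t ^+ a / t ^+ b)^-1).
  by apply: subringM => //; exact: subringX.
by field; rewrite !tX0 expf_neq0.
Qed.

(* The valuation ring [A] is local, so two terms that are not associated cannot
   cancel. *)
Lemma U_add_dominant x y : x != 0 -> y != 0 -> ~ U (x / y) ->
  U ((x + y) / x) \/ U ((x + y) / y).
Proof.
wlog Axy : x y / A (x / y) => [wlog_A|] x0 y0 nU.
  have [Axy|] := AP (x / y); first exact: wlog_A.
  rewrite invf_div => Ayx; rewrite or_comm addrC; apply: wlog_A => //.
  by move=> /UV; rewrite invf_div.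
right; have yE : (x + y) / y = 1 + x / y by field.
have nxy : ~ A (y / x).
  by move=> Ayx; apply: nU; split; rewrite ?mulf_neq0 ?invr_eq0 // invf_div.
have xy0 : x + y != 0.
  apply/eqP => /addr0_eq xy; apply: nxy; rewrite -xy mulNr divff //.
  by apply: subringN => //; exact: subring1.
split; first by rewrite mulf_neq0 ?invr_eq0.
  by rewrite yE; apply: subringD => //; exact: subring1.
have : A (x / (x + y)).
  have [//|] := AP (x / (x + y)); rewrite invf_div => Axyx; exfalso; apply: nxy.
  rewrite (_ : y / x = (x + y) / x - 1); last by field.
  by apply: subringB => //; exact: subring1.
move=> /(subringB sA (subring1 sA)); congr (A _); field.
by rewrite xy0 y0.
Qed.

(** In an equation q(x) = 0 over [R] two nonzero terms must be associated, because a sum of pairwise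
    non-associated terms is associated to one of them, hence nonzero. Comparing the two terms gives
    the value of [x]. *)
Lemma has_value_exists x : x != 0 -> exists r, has_value x r.
Proof.
move=> x0; apply: contrapT => nx.
have xX n : x ^+ n != 0 by exact: expf_neq0.
have [q [q0 Rq rq]] := R_alg x.
have nass i j : (i < j)%N -> q`_i != 0 -> q`_j != 0 ->
    ~ U ((q`_j * x ^+ j) / (q`_i * x ^+ i)).
  move=> ij qi0 qj0 Uij.
  have [ni [ui [Ui qi]]] := R_tX (Rq i) qi0; have [nj [uj [Uj qj]]] := R_tX (Rq j) qj0.
  apply: nx; exists ((ni%:R - nj%:R) / (j - i)%:R), (j - i)%N, nj, ni.
  split=> //; first by rewrite subn_gt0.
  move: Uij; rewrite qi qj => Uij.
  rewrite (_ : _ / _ = t ^+ nj * uj * x ^+ j / (t ^+ ni * ui * x ^+ i) * (ui / uj)).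
    by apply: UM => //; apply: UM => //; exact: UV.
  have [[ui0 _ _] [uj0 _ _]] := (Ui, Uj).
  have {2}-> : j = (i + (j - i))%N by rewrite subnKC // ltnW.
  by rewrite exprD; field; rewrite uj0 ui0 !tX0 xX.
have sums n : (forall i, (i < n)%N -> q`_i = 0) \/ exists i,
    [/\ (i < n)%N, q`_i != 0 & U ((\sum_(j < n) q`_j * x ^+ j) / (q`_i * x ^+ i))].
  elim: n => [|n [IHn|[i [lt_in qi0 Ui]]]]; first by left.
    have [qn|qn] := eqVneq q`_n 0.
      left=> i; rewrite ltnS leq_eqVlt => /orP[/eqP -> //|]; exact: IHn.
    right; exists n; split=> //; rewrite big_ord_recr big1 /= => [|j _].
      by rewrite add0r divff ?mulf_neq0.
    by rewrite IHn ?mul0r.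
  right; rewrite big_ord_recr /=; set s := \sum_(_ < n) _ in Ui *.
  have [qn|qn] := eqVneq q`_n 0.
    by exists i; split; rewrite ?qn ?mul0r ?addr0 // ltnW.
  have s0 : s != 0 by case: Ui => + _ _; apply: contraNneq => ->; rewrite mul0r.
  have i0 : q`_i * x ^+ i != 0 by rewrite mulf_neq0.
  have n0 : q`_n * x ^+ n != 0 by rewrite mulf_neq0.
  have nsn : ~ U (s / (q`_n * x ^+ n)).
    move=> Us; apply: (nass i n lt_in qi0 qn).
    have := UM Ui (UV Us); rewrite invf_div; congr U; field.
    by rewrite ?s0 ?qi0 ?qn ?xX.
  have [Us|Us] := U_add_dominant s0 n0 nsn.
    exists i; split=> //; first exact: ltnW.
    by have := UM Us Ui; congr U; rewrite mulrA divfK.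
  by exists n; split.
have [q_0|[i [_ qi0]]] := sums (size q).
  by move: (q0); rewrite -lead_coef_eq0 /lead_coef q_0 ?eqxx // ltn_predL size_poly_gt0.
by rewrite -horner_coef (rootP rq) mul0r => -[]; rewrite eqxx.
Qed.

Definition rational_value x : option ratG :=
  if x == 0 then None else Some (xget 0 (has_value x)).

Lemma rational_valueP x : x != 0 ->
  exists2 r, rational_value x = Some r & has_value x r.
Proof.
move=> x0; rewrite /rational_value (negPf x0); have [r xr] := has_value_exists x0.
by exists (xget 0 (has_value x)) => //; exact: (xgetPex 0 (ex_intro _ r xr)).
Qed.

Lemma rational_value_eq0 x : rational_value x = None <-> x = 0.
Proof. by rewrite /rational_value; case: eqP. Qed.

Lemma rational_valueE x r : has_value x r -> rational_value x = Some r.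
Proof.
move=> xr; have x0 : x != 0.
  apply/eqP => x0; have [m [a [b [m0 [+ _ _] _]]]] := xr.
  by rewrite x0 expr0n -[m == 0]negbK -lt0n m0 /= !mul0r eqxx.
by have [s -> xs] := rational_valueP x0; rewrite (has_value_uniq xr xs).
Qed.

Lemma rational_valueM x y :
  rational_value (x * y) = vadd (G := ratG) (rational_value x) (rational_value y).
Proof.
have [->|x0] := eqVneq x 0; first by rewrite mul0r /rational_value eqxx.
have [->|y0] := eqVneq y 0.
  by rewrite mulr0 /rational_value eqxx /=; case: ifP.
have [r -> xr] := rational_valueP x0; have [s -> ys] := rational_valueP y0.
exact: rational_valueE (has_valueM xr ys).
Qed.

Lemma rational_valueD x y :
  vle (G := ratG) (vmin (G := ratG) (rational_value x) (rational_value y))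
    (rational_value (x + y)).
Proof.
have None0 : rational_value 0 = None by exact/rational_value_eq0.
have [->|x0] := eqVneq x 0.
  by rewrite add0r None0 /vmin; case: (rational_value y) => //= r.
have [->|y0] := eqVneq y 0.
  by rewrite addr0 None0 /vmin; case: (rational_value x) => //= r.
have [xy|xy0] := eqVneq (x + y) 0.
  by rewrite xy None0; case: (vmin _ _).
have [r xE xr] := rational_valueP x0; have [s yE ys] := rational_valueP y0.
have [u -> xyu] := rational_valueP xy0; rewrite xE yE.
(* With r' <= s' the quotient y'/x' lies in [A], hence so does (x' + y')/x'. *)
have key x' y' r' s' : x' != 0 -> has_value x' r' -> has_value y' s' -> r' <= s' ->
    has_value (x' + y') u -> r' <= u.
  move=> x'0 x'r y's rs x'u.
  have [s1 _ xVs] := rational_valueP (invr_neq0 x'0).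
  have s1E : s1 = - r'.
    have := has_value_uniq (has_valueM x'r xVs); rewrite divff // => /(_ 0).
    have h1 : has_value 1 0 by have := has_value_tX 0 U1; rewrite mulr1.
    by move=> /(_ h1) /eqP; rewrite addrC addr_eq0 => /eqP.
  have := (has_value_ge0 (has_valueM y's xVs)).1; rewrite s1E subr_ge0 => /(_ rs) Ay.
  have := (has_value_ge0 (has_valueM x'u xVs)).2.
  rewrite s1E subr_ge0 mulrDl divff //; apply.
  by apply: subringD => //; exact: subring1.
rewrite /vmin /=; case: ifP => /= rs; first exact: key xr ys rs xyu.
apply: (key _ _ _ _ y0 ys xr); last by rewrite addrC.
by have := le_total r s; rewrite rs.
Qed.

Definition rational_valuation : valuation F ratG :=
  Valuation (valuation_fun := rational_value) rational_value_eq0 rational_valueM rational_valueD.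

Lemma rational_valuation_t : rational_valuation t = Some (1 : rat).
Proof.
by apply: rational_valueE; have := has_value_tX 1 U1; rewrite expr1 mulr1.
Qed.

Lemma rational_valuation_nat f : R f -> f != 0 ->
  exists n : nat, rational_valuation f = Some (n%:R : rat).
Proof.
move=> Rf f0; have [n [u [Uu ->]]] := R_tX Rf f0.
by exists n; apply: rational_valueE; exact: has_value_tX.
Qed.

End RationalValuation.

(** The construction of X enumerates the algebraic closure of F_p(t), which is countable because the
    fraction field is. *)
HB.instance Definition _ (R : countIdomainType) := [Countable of {ratio R} by <:].
HB.instance Definition _ (R : countIdomainType) :=
  Countable.copy {fraction R} (can_type (@reprK _ {fraction R})).

Lemma fractionP (R : idomainType) (x : {fraction R}) :
  exists n d : R, d != 0 /\ x = FracField.tofrac n / FracField.tofrac d.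
Proof.
elim/quotW: x => r; exists \n_r, \d_r; split; first exact: denom_ratioP.
have d0 : FracField.tofrac \d_r != 0 by rewrite tofrac_eq0 denom_ratioP.
apply: (mulIf d0); rewrite divfK // -[in LHS]/(FracField.mul _ _) !piE.
apply/eqP; rewrite piE FracField.equivfE /FracField.mulf.
by rewrite !numden_Ratio ?oner_eq0 ?mulr1 ?denom_ratioP // mulrC.
Qed.

(** Clears the denominators of an algebraic equation over the fraction field. *)
Lemma common_denominator (R : idomainType) (s : seq {fraction R}) :
  exists2 d : R, d != 0 & forall x, x \in s ->
    exists n : R, FracField.tofrac d * x = FracField.tofrac n.
Proof.
elim: s => [|x s [d d0 ds]]; first by exists 1; rewrite ?oner_neq0.
have [n [e [e0 ->]]] := fractionP x.
exists (d * e); first by rewrite mulf_neq0.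
move=> y; rewrite inE => /predU1P[->|/ds[m dy]].
  exists (d * n); rewrite !rmorphM /= -mulrA; congr (_ * _).
  by rewrite mulrCA divff ?tofrac_eq0 // mulr1.
by exists (e * m); rewrite !rmorphM /= -dy mulrAC mulrC.
Qed.

(** [R] is the image of F_p[t]. The integrality of its values is recorded because it rules out p
    v(d) = -1 for d in F_p(t). *)
Lemma valued_closed_field (p : nat) : prime p ->
  exists (O : countClosedFieldType) (v : valuation O ratG) (t : O) (R : set O),
    [/\ p \in [pchar O], is_subring R, R t, v t = Some (1 : rat)
      & forall f, R f -> f != 0 -> exists n : nat, v f = Some (n%:R : rat)].
Proof.
move=> p_prime.
have [O [phi phi_int]] := countable_algebraic_closure {fraction {poly 'F_p}}.
pose k : {rmorphism {poly 'F_p} -> O} := phi \o @FracField.tofrac {poly 'F_p}.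
have k_inj : injective k.
  by move=> a b /fmorph_inj /eqP; rewrite tofrac_eq => /eqP.
have k0 q : (k q == 0) = (q == 0) by rewrite -(inj_eq k_inj) rmorph0.
pose t := k 'X; pose R := range k.
have sR : is_subring R.
  split; first by exists 1; rewrite ?rmorph1.
    by move=> _ _ [a _ <-] [b _ <-]; exists (a - b); rewrite ?rmorphB.
  by move=> _ _ [a _ <-] [b _ <-]; exists (a * b); rewrite ?rmorphM.
have Rt : R t by exists 'X.
have t0 : t != 0 by rewrite k0 polyX_eq0.
have nRt : ~ R t^-1.
  move=> [q _ kq]; have : k ('X * q) = k 1.
    by rewrite rmorphM rmorph1 kq divff.
  move=> /k_inj /(congr1 (horner^~ 0)); rewrite hornerM hornerX mul0r hornerC.
  by move=> /eqP; rewrite eq_sym oner_eq0.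
have [A [sA RA nA Amax]] := maximal_subring sR nRt.
have R_tX f : R f -> f != 0 ->
    exists n u, [/\ u != 0, A u & A u^-1] /\ f = t ^+ n * u.
  move=> [q _ <-]; rewrite k0 => q0.
  (* After the power of t is split off, the cofactor r satisfies r(0) != 0. It is r(0) times some 1
     - ta with a in [R], which is a unit of [A]. *)
  have [n [r nr ->]] := multiplicity_XsubC q 0; rewrite q0 /= in nr; rewrite subr0.
  exists n, (k r); split; last by rewrite rmorphM rmorphXn mulrC.
  have r0 : r != 0 by apply: contraNneq nr => ->; rewrite root0.
  split; [by rewrite k0 | by apply: RA; exists r |].
  have /factor_theorem[s rs] : root (r - r.[0]%:P) 0.
    by rewrite /root !hornerE subrr.
  have c0 : r.[0] != 0 by [].
  have rE : k (r.[0]^-1%:P * r) = 1 - t * k (- (r.[0]^-1%:P * s)).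
    rewrite -(rmorph1 k) -!rmorphM -rmorphB; congr (k _).
    move: rs; rewrite subr0 => /(canRL (subrK _)); move: c0; move: r.[0] => c c0 ->.
    by rewrite mulrDr -polyCM mulVf // mulrN opprK mulrA addrC [_ * 'X]mulrC.
  have -> : (k r)^-1 = k (r.[0]^-1%:P) * (1 - t * k (- (r.[0]^-1%:P * s)))^-1.
    have kc0 : k (r.[0]^-1%:P) != 0 by rewrite k0 polyC_eq0 invr_eq0.
    by rewrite -rE rmorphM invfM mulrA divff // mul1r.
  apply: (subringM sA); first by apply: RA; exists (r.[0]^-1%:P).
  apply: (one_sub_inv sR Rt nRt sA RA nA Amax).
  by apply: RA; eexists.
have R_alg x : exists q, [/\ q != 0, coefs_in R q & root q x].
  have [q q_monic rq] := phi_int x.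
  have [d d0 dP] := common_denominator q.
  have q0 := monic_neq0 q_monic.
  exists (map_poly phi (FracField.tofrac d *: q)); split.
  - by rewrite map_poly_eq0 scaler_eq0 tofrac_eq0 negb_or d0.
  - move=> i; rewrite coef_map coefZ; have [iq|qi] := ltnP i (size q).
      by have [n ->] := dP _ (mem_nth 0 iq); exists n.
    have R0 y : y = 0 -> R (phi y) by move=> ->; rewrite rmorph0; exact: subring0.
    by apply: R0; rewrite nth_default // mulr0.
  - by rewrite linearZ /= rootZ // fmorph_eq0 tofrac_eq0.
have AP := valuation_ringP sR Rt nRt sA RA nA Amax.
exists O, (rational_valuation sA t0 (RA _ Rt) nA AP R_tX R_alg), t, R; split=> //.
- exact: (rmorph_pchar k (rmorph_pchar (@polyC 'F_p) (pchar_Fp p_prime))).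
- exact: rational_valuation_t.
- exact: rational_valuation_nat.
Qed.

(** * The perfect henselian field *)

Lemma exprXB_pchar (R : comNzRingType) p n (x y : R) :
  p \in [pchar R] -> (x - y) ^+ (p ^ n) = x ^+ (p ^ n) - y ^+ (p ^ n).
Proof.
move=> cp; elim: n x y => [|n IHn] x y; first by rewrite !expr1.
by rewrite expnS !exprM exprB_pchar // IHn.
Qed.

Lemma rat_le_nat (g : rat) : exists n : nat, g <= n%:R.
Proof.
exists (Num.truncn `|g|).+1; apply: le_trans (ler_norm g) _.
exact/ltW/truncnS_gt.
Qed.

Lemma closed_root (F : closedFieldType) n (x : F) : (0 < n)%N -> exists y, y ^+ n = x.
Proof.
move=> n0; have [y yn] := solve_monicpoly (fun i => if i == 0 then x else 0) n0.
exists y; rewrite yn; case: n n0 yn => // n _ _.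
by rewrite big_ord_recl big1 ?addr0 ?mulr1 // => i _; rewrite mul0r.
Qed.

Lemma closed_artin_schreier_root (F : closedFieldType) n (a : F) :
  (1 < n)%N -> exists y, y ^+ n - y = a.
Proof.
case: n => [|[|n]] // _.
have [y yn] := solve_monicpoly (fun i => if i == 0 then a else (i == 1)%:R) (ltn0Sn n.+1).
exists y; rewrite yn !big_ord_recl big1 ?addr0 /= => [|i _]; last by rewrite mul0r.
by rewrite expr0 mulr1 mul1r expr1 addrK.
Qed.

Section IntegralPolynomials.
Context (F : fieldType) (G : orderedGroupType) (v : valuation F G).
Implicit Types (q : {poly F}) (x y : F).

Lemma vge0_horner q x : (forall i, vge v 0 q`_i) -> vge v 0 x -> vge v 0 q.[x].
Proof.
move=> q0 x0; rewrite horner_coef; apply: vge_sum => i _.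
by rewrite -[X in vge _ X](mul0rn _ i) -[X in vge _ X]add0r; apply: vgeM => //; exact: vgeX.
Qed.

Lemma vge0_muln x n : vge v 0 x -> vge v 0 (x *+ n).
Proof.
by move=> x0; rewrite -mulr_natr -[X in vge _ X]addr0; apply: vgeM => //; exact: vge0_nat.
Qed.

Lemma vge0_nderivn q n : (forall i, vge v 0 q`_i) -> forall i, vge v 0 q^`N(n)`_i.
Proof. by move=> q0 i; rewrite coef_nderivn; exact: vge0_muln. Qed.

Lemma vge0_deriv q : (forall i, vge v 0 q`_i) -> forall i, vge v 0 q^`()`_i.
Proof. by move=> q0 i; rewrite coef_deriv; exact: vge0_muln. Qed.

Lemma vge0_pow x g n : 0 <= g -> vge v g x -> vge v g (x ^+ n.+1).
Proof.
move=> g0 xg; rewrite exprS -[X in vge _ X]addr0; apply: vgeM => //.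
by rewrite -(mul0rn _ n); apply: vgeX; exact: vge_le xg.
Qed.

Lemma vge_horner_sub q x y g : (forall i, vge v 0 q`_i) -> vge v 0 y -> 0 <= g ->
  vge v g (x - y) -> vge v g (q.[x] - q.[y]).
Proof.
move=> q0 y0 g0 xy; rewrite taylor_sub; apply: vge_sum => i _.
rewrite -[X in vge _ X]add0r; apply: vgeM; last exact: vge0_pow.
exact/vge0_horner/y0/vge0_nderivn.
Qed.

(** The quadratic error estimate behind Newton's method. *)
Lemma vge_taylor2 q x y g : (forall i, vge v 0 q`_i) -> vge v 0 y -> 0 <= g ->
  vge v g (x - y) -> vge v (g + g) (q.[x] - q.[y] - q^`().[y] * (x - y)).
Proof.
move=> q0 y0 g0 xy; rewrite taylor_sub.
case sq: (size q).-1 => [|m].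
  rewrite big_ord0 (_ : q^`() = 0) ?horner0 ?mul0r ?subr0 ?vge0 //.
  rewrite (@size1_polyC _ q) ?derivC //; by case: (size q) sq => [|[|]].
rewrite big_ord_recl /= nderivn1 expr1 addrAC subrr add0r; apply: vge_sum => i _.
rewrite -[X in vge _ X]add0r; apply: vgeM.
  exact/vge0_horner/y0/vge0_nderivn.
by rewrite /bump /= add1n exprS; apply: vgeM => //; exact: vge0_pow.
Qed.

End IntegralPolynomials.

(* If no root of [q] is close to [a], then [q'/q = sum 1 / (X - r)] is integral at [a]. *)
Lemma closed_henselian (F : closedFieldType) (G : orderedGroupType)
    (v : valuation F G) (q : {poly F}) (a : F) :
  vgt v 0 q.[a] -> v q^`().[a] = Some 0 -> exists2 b, root q b & vgt v 0 (b - a).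
Proof.
move=> qa dqa; apply: contrapT => nb.
have q0 : q != 0 by apply/eqP => q0; move: dqa; rewrite q0 deriv0 horner0 w0.
have [s qE] := closed_field_poly_normal q.
have far r : r \in s -> exists2 h, v (a - r) = Some h & h <= 0.
  move=> rs; have [near_r|//] := vgt_total v (a - r) 0.
  exfalso; apply: nb; exists r; last by rewrite -vgtN opprB.
  by rewrite qE rootZ ?lead_coef_eq0 // root_prod_XsubC.
have bound : exists2 h, v (\prod_(r <- s) ('X - r%:P)).[a] = Some h
    & vge v h (\prod_(r <- s) ('X - r%:P))^`().[a].
  elim: s far {qE} => [|r s IHs] far.
    by rewrite big_nil; exists 0; rewrite ?hornerC ?w1 // derivC horner0 vge0.
  have [r' r's|h vh dh] := IHs _; first by apply: far; rewrite inE r's orbT.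
  have [g vg g0] := far r (mem_head _ _); rewrite big_cons.
  exists (g + h); first by rewrite hornerM !hornerE; exact: wM.
  rewrite derivM derivXsubC mul1r hornerD hornerM !hornerE; apply: vgeD.
    apply: vge_le (vge_eq vh); by rewrite -[X in _ <= X]add0r og_leD.
  by apply: vgeM => //; exact: vge_eq.
case: bound => h vh dh; set Q := \prod_(r <- s) _ in qE vh dh.
have [l vl] : exists l, v (lead_coef q) = Some l by apply: w_some; rewrite lead_coef_eq0.
have vq : v q.[a] = Some (l + h) by rewrite qE hornerZ; exact: wM.
have : vge v (l + h) q^`().[a].
  by rewrite {1}qE derivZ hornerZ; apply: vgeM => //; exact: vge_eq.
rewrite (vge_some _ dqa) => le0; move: qa; rewrite (vgt_some _ vq).
by rewrite og_ltNge le0.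
Qed.

(** * The closure of the perfect hull of F_p(t) *)

Section PerfectClosure.
Context (O : closedFieldType) (v : valuation O ratG) (t : O) (R : set O) (p : nat).
Hypotheses (p_char : p \in [pchar O]) (sR : is_subring R) (Rt : R t).
Hypothesis vt : v t = Some (1 : rat).
Hypothesis R_int : forall f, R f -> f != 0 -> exists n : nat, v f = Some (n%:R : rat).

Let p_prime : prime p. Proof. exact: pcharf_prime p_char. Qed.
Let p_gt0 : (0 < p)%N. Proof. exact: prime_gt0. Qed.
Let p_gt1 : (1 < p)%N. Proof. exact: prime_gt1. Qed.
Let t0 : t != 0. Proof. exact: w_neq0 vt. Qed.

Definition quotients : set O := [set x | exists f g, [/\ R f, R g & x = f / g]].

Definition perfect_quotients : set O :=
  [set x | exists n, quotients (x ^+ (p ^ n))].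

(** A completion taken inside [O], so that it inherits the countability of [O] in the
    application. *)
Definition complete_perfect : set O := vclosure v perfect_quotients.

Lemma quotients_subfield : subfield quotients.
Proof.
apply/subfieldP; split; first by exists 1, 1; rewrite divr1; split=> //; exact: subring1.
- move=> _ _ [a [b [Ra Rb ->]]] [c [d [Rc Rd ->]]].
  have [->|b0] := eqVneq b 0.
    by exists (- c), d; split=> //; [exact: subringN | rewrite invr0 mulr0 sub0r mulNr].
  have [->|d0] := eqVneq d 0.
    by exists a, b; split=> //; rewrite invr0 mulr0 subr0.
  exists (a * d - c * b), (b * d); split; last by field; rewrite b0 d0.
    by apply: subringB => //; exact: subringM.
  exact: subringM.
- move=> _ _ [a [b [Ra Rb ->]]] [c [d [Rc Rd ->]]].
  exists (a * d), (b * c); split; [exact: subringM | exact: subringM |].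
  by rewrite invf_div mulf_div.
Qed.

Lemma quotients_int x : quotients x -> x != 0 ->
  exists z : int, v x = Some (z%:~R : rat).
Proof.
move=> [f [g [Rf Rg ->]]]; rewrite mulf_eq0 invr_eq0 negb_or => /andP[f0 g0].
have [m vf] := R_int Rf f0; have [n vg] := R_int Rg g0.
by exists (m%:Z - n%:Z); rewrite (wM vf (wV vg)) rmorphB.
Qed.

Let qX x m n : quotients (x ^+ (p ^ m)) -> (m <= n)%N -> quotients (x ^+ (p ^ n)).
Proof.
by move=> qx mn; rewrite -(subnKC mn) expnD exprM; exact: (subfieldX quotients_subfield).
Qed.

Lemma perfect_quotients_subfield : subfield perfect_quotients.
Proof.
have sq := quotients_subfield.
have common x y : perfect_quotients x -> perfect_quotients y ->
    exists n, quotients (x ^+ (p ^ n)) /\ quotients (y ^+ (p ^ n)).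
  move=> [m qx] [n qy]; exists (maxn m n); split.
    exact: qX qx (leq_maxl _ _).
  exact: qX qy (leq_maxr _ _).
apply/subfieldP; split; first by exists 0%N; rewrite expr1; exact: subfield1.
- move=> x y Px Py; have [n [qx qy]] := common x y Px Py; exists n.
  by rewrite exprXB_pchar //; exact: subfieldB.
- move=> x y Px Py; have [n [qx qy]] := common x y Px Py; exists n.
  by rewrite exprMn exprVn; exact: subfield_div.
Qed.

Lemma quotients_t : quotients t.
Proof. by exists t, 1; rewrite divr1; split=> //; exact: subring1. Qed.

Lemma sub_perfect_quotients : quotients `<=` perfect_quotients.
Proof. by move=> x qx; exists 0%N; rewrite expr1. Qed.

Lemma perfect_quotients_cofinal (g : rat) :
  exists2 h : rat, value_group v perfect_quotients h & g <= h.
Proof.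
have [n gn] := rat_le_nat g; exists n%:R => //; exists (t ^+ n); last exact: wX vt.
by apply: sub_perfect_quotients; apply: (subfieldX quotients_subfield); exact: quotients_t.
Qed.

Lemma complete_perfect_subfield : subfield complete_perfect.
Proof.
apply: vclosure_subfield; first exact: perfect_quotients_subfield.
by move=> y h _; exact: perfect_quotients_cofinal.
Qed.

Lemma complete_perfect_dense y (g : rat) : complete_perfect y ->
  exists2 x, perfect_quotients x & vgt v g (y - x).
Proof.
have [h Dh gh] := perfect_quotients_cofinal g.
by move=> /(_ h Dh)[x Px yx]; exists x => //; exact: vgt_le yx.
Qed.

Lemma complete_perfectP y : (forall g : rat, exists2 x, complete_perfect x & vgt v g (y - x)) ->
  complete_perfect y.
Proof.
move=> Cy g Dg; have [x Cx yx] := Cy g; have [x' Px' xx'] := Cx g Dg.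
by exists x' => //; rewrite (_ : y - x' = (y - x) + (x - x')); [exact: vgtD | ring].
Qed.

Lemma vgt_root y (g : rat) n : (0 < n)%N -> vgt v (g *+ n) (y ^+ n) -> vgt v g y.
Proof.
move=> n0 yn; have [//|[h vy hg]] := vgt_total v y g.
move: yn; rewrite (vgt_some _ (wX n vy)) => lt_gh.
have : (h : rat) *+ n <= g *+ n by rewrite ler_wMn2r.
by rewrite leNgt lt_gh.
Qed.

(** Extraction of p-th roots is continuous, since Frobenius is additive and multiplies values by
    [p]. *)
Lemma complete_perfect_root y : complete_perfect y ->
  exists2 x, complete_perfect x & x ^+ p = y.
Proof.
move=> Cy; have [x xp] := closed_root y p_gt0; exists x => // g _.
have [z [n qz] yz] := complete_perfect_dense (g *+ p) Cy.
have [z' zp] := closed_root z p_gt0; exists z'.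
  by exists n.+1; rewrite expnS exprM zp.
by apply: (vgt_root p_gt0); rewrite exprB_pchar // xp zp.
Qed.

Lemma sub_complete_perfect : perfect_quotients `<=` complete_perfect.
Proof. exact: sub_vclosure. Qed.

(** The algebraically closed field provides a root near [a]; Newton's iterates lie in the subfield
    and converge to it. *)
Lemma complete_perfect_henselian (q : {poly O}) a :
  (forall i, complete_perfect q`_i /\ vge v 0 q`_i) ->
  complete_perfect a -> vge v 0 a -> vgt v 0 q.[a] -> v q^`().[a] = Some 0 ->
  exists b, [/\ complete_perfect b, root q b & vgt v 0 (b - a)].
Proof.
move=> Cq Ca a0 qa dqa; have [b rb ba] := closed_henselian qa dqa.
have sC := complete_perfect_subfield.
exists b; split=> //; have [-> //|nba] := eqVneq b a.
have [e ve] : exists e, v (b - a) = Some e by apply: w_some; rewrite subr_eq0.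
have e0 : (0 : rat) < e by rewrite (vgt_some _ ve) in ba.
have q0 i : vge v 0 q`_i by case: (Cq i).
(* Newton's method: every step adds [e] to the value of [b - x]. *)
have step n : exists x, [/\ complete_perfect x, vge v 0 x, vge v e (x - a)
    & vge v (e *+ n.+1) (b - x)].
  elim: n => [|n [x [Cx x0 xa bx]]].
    by exists a; split=> //; rewrite ?subrr ?vge0 //; exact: vge_eq.
  have en : e <= e *+ n.+1 by rewrite -[X in X <= _]mulr1n ler_pMn2l.
  have dqx : v q^`().[x] = Some 0.
    rewrite -(subrK q^`().[a] q^`().[x]) addrC; apply: (wDl dqa).
    have H : vge v e (q^`().[x] - q^`().[a]).
      by apply: vge_horner_sub => //; [exact: vge0_deriv | exact: ltW].
    by apply: vge_lt H; exact: e0.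
  have dx0 := w_neq0 dqx.
  have Cqx (r : {poly O}) : (forall i, complete_perfect r`_i) -> complete_perfect r.[x].
    by move=> Cr; apply: (subfield_horner sC).
  have bx' : vge v (e *+ n.+2) (b - (x - q.[x] / q^`().[x])).
    have e'0 : (0 : ratG) <= e *+ n.+1 by exact: le_trans (ltW e0) en.
    have := vge_taylor2 q0 x0 e'0 bx.
    rewrite (rootP rb) sub0r => bx2.
    have -> : b - (x - q.[x] / q^`().[x]) =
      - ((- q.[x] - q^`().[x] * (b - x)) * (q^`().[x])^-1) by field.
    rewrite vgeN; apply: vge_le (vgeM bx2 (vge_eq (wV dqx))).
    by rewrite /= oppr0 addr0 [_ *+ n.+2]mulrS lerD2r.
  have xa' : vge v e (x - q.[x] / q^`().[x] - a).
    rewrite (_ : _ - a = (b - a) - (b - (x - q.[x] / q^`().[x]))); last by ring.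
    apply: vgeB; first exact: vge_eq.
    by apply: vge_le bx'; rewrite /= -[X in X <= _]mulr1n ler_pMn2l.
  exists (x - q.[x] / q^`().[x]); split=> //.
    apply: (subfieldB sC Cx); apply: (subfield_div sC); apply: Cqx => i.
      by case: (Cq i).
    rewrite coef_deriv -mulr_natr; apply: (subfieldM sC); first by case: (Cq i.+1).
    exact: subfield_nat.
  by rewrite -(subrK a (x - _)); apply: vgeD => //; apply: vge_le xa'; exact: ltW.
apply: complete_perfectP => g.
have [n gn] := rat_le_nat (g / e).
have [x [Cx _ _ bx]] := step n; exists x => //; apply: vge_lt bx.
rewrite /= -mulr_natr mulrC -ltr_pdivrMr // (le_lt_trans gn) // ltr_nat //.
Qed.

(** For n = 0 the value -1 of 1/t would have to be p v(d) with v(d) an integer. Subtracting t^(-p^n)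
    from d passes from n + 1 to n, because t^(-p^n) and its p-th power differ by an Artin-Schreier
    image. *)
Lemma no_pseudo_root_quotients n d : quotients d ->
  ~ vge v 0 (d ^+ p - d - t ^- (p ^ n)).
Proof.
elim: n d => [|n IHn] d qd.
  rewrite expr1; have vtV : v t^-1 = Some (-1 : rat) := wV vt.
  have [->|d0] := eqVneq d 0.
    by rewrite expr0n gtn_eqF // subrr sub0r vgeN (vge_some _ vtV).
  have [z vd] := quotients_int qd d0.
  have [z0|z0] := leP 0 z.
    move=> H; have : vge v 0 t^-1; last by rewrite (vge_some _ vtV).
    rewrite -(subKr (d ^+ p - d) t^-1); apply: vgeB => //.
    have vd0 : vge v 0 d by rewrite (vge_some _ vd) /= ler0z.
    by apply: vgeB => //; rewrite -(mul0rn _ p); exact: vgeX.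
  have vdp : v (d ^+ p - d) = Some (z%:~R *+ p : rat).
    apply: (wDl (wX p vd)); rewrite vgtN (vgt_some _ vd) /=.
    have zr : z%:~R < 0 :> rat by rewrite ltrz0.
    by rewrite -[X in _ < X]mulr1n ltr_nMn2l.
  have [h|h] := eqVneq (z%:~R *+ p : rat) (-1).
    exfalso; have : (z *+ p)%:~R = (-1)%:~R :> rat by rewrite rmorphMn /= h.
    move=> /eqP; rewrite eqr_int => /eqP zp; move: zp p_gt1 z0; clear.
    rewrite -mulr_natr; nia.
  move=> X0; move: h; suff : Some (z%:~R *+ p : rat) = Some (-1 : rat) by case=> ->; rewrite eqxx.
  rewrite -vtV -(subKr (d ^+ p - d) t^-1); apply/esym/(wDl vdp).
  by rewrite vgtN; apply: vge_lt X0; rewrite /= mulrn_wlt0 // ltrz0.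
have -> : d ^+ p - d - t ^- (p ^ n.+1) =
    (d - t ^- (p ^ n)) ^+ p - (d - t ^- (p ^ n)) - t ^- (p ^ n).
  have tE : t ^- (p ^ n.+1) = (t ^- (p ^ n)) ^+ p by rewrite expnSr exprM exprVn.
  by rewrite exprB_pchar // -tE; ring.
apply: IHn; apply: (subfieldB quotients_subfield) => //.
apply: (subfieldV quotients_subfield); apply: (subfieldX quotients_subfield).
exact: quotients_t.
Qed.

(** Approximate [c] by an element of the perfect hull and apply a power of Frobenius that carries
    this element into F_p(t). *)
Lemma no_pseudo_root c : complete_perfect c -> ~ vge v 0 (c ^+ p - c - t^-1).
Proof.
move=> Cc Pc; have [x [n qx] cx] := complete_perfect_dense 0 Cc.
apply: (no_pseudo_root_quotients (n := n) qx).
have -> : (x ^+ (p ^ n)) ^+ p - x ^+ (p ^ n) - t ^- (p ^ n) = (x ^+ p - x - t^-1) ^+ (p ^ n).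
  by rewrite !exprXB_pchar // exprVn -!exprM mulnC.
rewrite -(mul0rn _ (p ^ n)); apply: vgeX.
have -> : x ^+ p - x - t^-1 = (c ^+ p - c - t^-1) - ((c - x) ^+ p - (c - x)).
  by rewrite exprB_pchar //; ring.
apply: vgeB => //; have cx0 := vgtW cx; apply: vgeB => //.
by rewrite -(mul0rn _ p); exact: vgeX.
Qed.

End PerfectClosure.

(** * The valuation of the rational function field *)

Lemma sub_frac (F : fieldType) (n d a b : F) : d != 0 -> b != 0 ->
  n / d - a / b = ((n - a) * b + - (d - b) * a) * (d^-1 * b^-1).
Proof. by move=> d0 b0; field; rewrite d0 b0. Qed.

Section Evaluation.
Context (K : fieldType) (O : closedFieldType) (G : orderedGroupType) (v : valuation O G).
Context (k : {rmorphism K -> O}) (x : nat -> O).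

(* Every [r] stays at a finite distance from [x n], beyond which [x] is Cauchy. *)
Hypothesis x_avoids : forall r, exists N h, forall n, (N <= n)%N ->
  v (x n - r) = Some h /\ forall m, (n <= m)%N -> vgt v h (x m - x n).

Definition eventually (A : nat -> Prop) := exists N, forall n, (N <= n)%N -> A n.

Lemma eventually_and A B : eventually A -> eventually B -> eventually (fun n => A n /\ B n).
Proof.
move=> [N AN] [M BM]; exists (maxn N M) => n; rewrite geq_max => /andP[/AN ? /BM ?].
by [].
Qed.

Lemma eventuallyS (A B : nat -> Prop) : (forall n, A n -> B n) -> eventually A -> eventually B.
Proof. by move=> AB [N AN]; exists N => n /AN /AB. Qed.

Lemma eventually_ex A : eventually A -> exists n, A n.
Proof. by move=> [N AN]; exists N; apply: AN. Qed.

(** Over an algebraically closed field [Q] splits, and [x_avoids] makes each linear factor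
    stable. *)
Lemma eval_stable (Q : {poly O}) : Q != 0 -> exists h,
  eventually (fun n => v Q.[x n] = Some h /\
    forall m, (n <= m)%N -> vgt v h (Q.[x m] - Q.[x n])).
Proof.
move=> Q0; have [s ->] := closed_field_poly_normal Q.
have [l vl] : exists l, v (lead_coef Q) = Some l by apply: w_some; rewrite lead_coef_eq0.
elim: s => [|r s [h IHs]].
  rewrite big_nil alg_polyC; exists l, 0%N => n _.
  by rewrite !hornerC; split=> // m _; rewrite hornerC subrr vgt0.
have [N [g xr]] := x_avoids r.
exists (g + h); apply: eventuallyS (eventually_and IHs (ex_intro _ N xr)).
move=> n [[vn near_n] [vxr near_x]].
rewrite big_cons scalerAr; set P := lead_coef Q *: _ in vn near_n *.
have E m : (('X - r%:P) * P).[x m] = (x m - r) * P.[x m].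
  by rewrite hornerM !hornerE.
rewrite E; split=> [|m nm]; first exact: wM.
rewrite E (_ : _ - _ = (x m - x n) * P.[x m] + (P.[x m] - P.[x n]) * (x n - r)); last by ring.
apply: vgtD.
  apply: vgtM (near_x m nm) _; rewrite -(subrK P.[x n] P.[x m]); apply: vgeD.
    exact/vgtW/near_n.
  exact: vge_eq.
by rewrite addrC; apply: vgtM (near_n m nm) (vge_eq vxr).
Qed.

Let ev n (Q : {poly K}) : O := (map_poly k Q).[x n].

Lemma ev_stable Q : Q != 0 -> exists h, eventually (fun n => v (ev n Q) = Some h /\
    forall m, (n <= m)%N -> vgt v h (ev m Q - ev n Q)).
Proof. by move=> Q0; apply: eval_stable; rewrite map_poly_eq0. Qed.

Lemma ev_neq0 Q : Q != 0 -> eventually (fun n => ev n Q != 0).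
Proof.
move=> /ev_stable[h]; apply: eventuallyS => n [vn _]; exact: w_neq0 vn.
Qed.

Lemma ratfun_frac (y : ratfun K) : exists ND : {poly K} * {poly K},
  ND.2 != 0 /\ y = rat_poly ND.1 / rat_poly ND.2.
Proof. by have [n [d [d0 yE]]] := fractionP y; exists (n, d). Qed.

Let num y := (sval (cid (ratfun_frac y))).1.
Let den y := (sval (cid (ratfun_frac y))).2.

Let den0 y : den y != 0. Proof. by rewrite /den; case: cid => ND []. Qed.
Let num_den y : y = rat_poly (num y) / rat_poly (den y).
Proof. by rewrite /num /den; case: cid => ND []. Qed.

(** Where the denominator vanishes the quotient has the default value 0. This and the choice of the
    representatives affect finitely many n only. *)
Definition rat_eval n y : O := ev n (num y) / ev n (den y).

Lemma rat_evalE (N D : {poly K}) y : D != 0 -> y = rat_poly N / rat_poly D ->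
  eventually (fun n => rat_eval n y = ev n N / ev n D).
Proof.
move=> D0 yE; apply: eventuallyS (eventually_and (ev_neq0 D0) (ev_neq0 (den0 y))).
move=> n [eD0 ed0]; rewrite /rat_eval.
have E : num y * D = N * den y.
  apply/eqP; rewrite -subr_eq0 -rat_poly_eq0 rat_polyB !rat_polyM subr_eq0; apply/eqP.
  move: yE; rewrite {1}(num_den y) => /eqP; rewrite eqr_div ?rat_poly_eq0 //.
  by move/eqP.
apply/eqP; rewrite eqr_div // /ev -!hornerM -!rmorphM E mulrC eqxx //.
Qed.

Lemma rat_eval_poly Q : eventually (fun n => rat_eval n (rat_poly Q) = ev n Q).
Proof.
have := @rat_evalE Q 1 (rat_poly Q) (oner_neq0 _).
rewrite /rat_poly rmorph1 divr1 => /(_ erefl); apply: eventuallyS => n ->.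
by rewrite /ev rmorph1 hornerC divr1.
Qed.

Lemma rat_evalD y z : eventually (fun n => rat_eval n (y + z) = rat_eval n y + rat_eval n z).
Proof.
have yz : y + z = rat_poly (num y * den z + num z * den y) / rat_poly (den y * den z).
  rewrite {1}(num_den y) {1}(num_den z) rat_polyD !rat_polyM addf_div ?rat_poly_eq0 //.
have := rat_evalE (mulf_neq0 (den0 y) (den0 z)) yz.
move=> H; apply: eventuallyS (eventually_and H (eventually_and (ev_neq0 (den0 y)) (ev_neq0 (den0 z)))).
by move=> n [-> [dy dz]]; rewrite /rat_eval addf_div // /ev rmorphD !rmorphM hornerD !hornerM.
Qed.

Lemma rat_evalM y z : eventually (fun n => rat_eval n (y * z) = rat_eval n y * rat_eval n z).
Proof.
have yz : y * z = rat_poly (num y * num z) / rat_poly (den y * den z).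
  by rewrite {1}(num_den y) {1}(num_den z) !rat_polyM mulf_div.
apply: eventuallyS (rat_evalE (mulf_neq0 (den0 y) (den0 z)) yz) => n ->.
by rewrite /rat_eval mulf_div /ev !rmorphM !hornerM.
Qed.

Let lim_val y (h : option G) := eventually (fun n => v (rat_eval n y) = h).

Lemma lim_val_uniq y h h' : lim_val y h -> lim_val y h' -> h = h'.
Proof. by move=> yh /(eventually_and yh)/eventually_ex[n [<- <-]]. Qed.

Lemma lim_val_neq0 y : y != 0 -> exists g, lim_val y (Some g).
Proof.
move=> y0; have ny : num y != 0.
  by apply: contraNneq y0 => ny; rewrite (num_den y) ny /rat_poly rmorph0 mul0r.
have [h vh] := ev_stable ny; have [h' vh'] := ev_stable (den0 y).
exists (h - h'); apply: eventuallyS (eventually_and vh vh') => n [[vn _] [vd _]].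
exact: wM vn (wV vd).
Qed.

Lemma lim_val0 : lim_val 0 None.
Proof.
have := rat_eval_poly 0; rewrite /rat_poly rmorph0; apply: eventuallyS => n ->.
by rewrite /ev rmorph0 horner0 w0.
Qed.

Lemma lim_val_ex y : exists h, lim_val y h.
Proof.
have [->|/lim_val_neq0[g yg]] := eqVneq y 0; first by exists None; exact: lim_val0.
by exists (Some g).
Qed.

Let lim y : option G := sval (cid (lim_val_ex y)).
Let limP y : lim_val y (lim y). Proof. by rewrite /lim; case: cid. Qed.

Let lim_eq0 y : lim y = None <-> y = 0.
Proof.
split=> [ly|->]; last exact: lim_val_uniq (limP 0) lim_val0.
apply/eqP/negPn/negP => /lim_val_neq0[g yg].
by have := lim_val_uniq (limP y) yg; rewrite ly.
Qed.

Let limM y z : lim (y * z) = vadd (lim y) (lim z).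
Proof.
have [n [[<- <-] [<- ->]]] := eventually_ex (eventually_and
  (eventually_and (limP y) (limP z)) (eventually_and (limP (y * z)) (rat_evalM y z))).
exact: valuationM.
Qed.

Let limD y z : vle (vmin (lim y) (lim z)) (lim (y + z)).
Proof.
have [n [[<- <-] [<- ->]]] := eventually_ex (eventually_and
  (eventually_and (limP y) (limP z)) (eventually_and (limP (y + z)) (rat_evalD y z))).
exact: valuationD.
Qed.

Definition limit_valuation : valuation (ratfun K) G := Valuation lim_eq0 limM limD.

Lemma limit_valuation_poly Q h :
  eventually (fun n => v (ev n Q) = h) -> limit_valuation (rat_poly Q) = h.
Proof.
move=> Qh; apply: lim_val_uniq (limP _) _.
by apply: eventuallyS (eventually_and Qh (rat_eval_poly Q)) => n [<- ->].
Qed.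

Lemma limit_valuation_poly_gt Q g :
  eventually (fun n => vgt v g (ev n Q)) -> vgt limit_valuation g (rat_poly Q).
Proof.
move=> Qg; have [n [vn [lQ eQ]]] := eventually_ex (eventually_and Qg
  (eventually_and (limP (rat_poly Q)) (rat_eval_poly Q))).
by rewrite /vgt /= -lQ eQ.
Qed.

Hypothesis dense_x : forall (Q : {poly K}) n h, v (ev n Q) = Some h ->
  exists c, vgt v h (ev n Q - k c).

(** An approximation of Q(x_N) serves all later n as well, because Q(x_n) - Q(x_N) has a value
    greater than [h]. *)
Lemma limit_valuation_dense_poly Q : Q != 0 ->
  exists c h, [/\ limit_valuation (rat_poly Q) = Some h,
    vgt limit_valuation h (rat_poly Q - rat_const c) & v (k c) = Some h].
Proof.
move=> /ev_stable[h Qh]; have [N QN] := Qh.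
have [vN near_N] := QN N (leqnn N).
have [c cN] := dense_x vN; exists c, h; split; last exact: wBr vN cN.
  by apply: limit_valuation_poly; apply: eventuallyS Qh => n [].
rewrite /rat_const -rat_polyB; apply: limit_valuation_poly_gt.
exists N => n Nn; rewrite /ev rmorphB /= map_polyC hornerD hornerN hornerC.
rewrite -/(ev n Q) (_ : _ - _ = (ev n Q - ev N Q) + (ev N Q - k c)); last by ring.
by apply: vgtD => //; exact: near_N.
Qed.

Lemma limit_valuation_const c : limit_valuation (rat_const c) = v (k c).
Proof.
apply: limit_valuation_poly; exists 0%N => n _.
by rewrite /ev map_polyC hornerC.
Qed.

Lemma limit_valuation_dense y g : limit_valuation y = Some g ->
  exists c, vgt limit_valuation g (y - rat_const c).
Proof.
move=> vy; have y0 := w_neq0 vy.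
have ny : num y != 0.
  by apply: contraNneq y0 => ny; rewrite (num_den y) ny /rat_poly rmorph0 mul0r.
have [c [h [vn nc kc]]] := limit_valuation_dense_poly ny.
have [d [e [vd de kd]]] := limit_valuation_dense_poly (den0 y).
have gE : g = h - e.
  by have := wM vn (wV vd); rewrite -num_den vy => -[].
have wc : limit_valuation (rat_const c) = Some h by rewrite limit_valuation_const.
have wd : limit_valuation (rat_const d) = Some e by rewrite limit_valuation_const.
have [D0 d0] := (w_neq0 vd, w_neq0 wd).
exists (c / d); rewrite rat_constM rat_constV {1}(num_den y) gE.
set N := rat_poly (num y) in vn nc *; set D := rat_poly (den y) in vd de D0 *.
rewrite (sub_frac _ _ D0 d0).
have -> : h - e = (h + e) + (- e - e) by rewrite addrA addrK.
apply: vgtM; last exact: vge_eq (wM (wV vd) (wV wd)).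
apply: vgtD; first exact: vgtM nc (vge_eq wd).
by rewrite addrC; apply: vgtM (vge_eq wc); rewrite vgtN.
Qed.

End Evaluation.

(** The multiples of a positive rational number exceed every rational number. *)
Lemma rat_rank_one (D : set ratG) : zmod_closed (mem D) -> D <> [set 0] -> rank_one D.
Proof.
move=> [_ DB] D0; split=> // H [HD [H0 HB] Hconv].
have H_0 : H 0 by move: H0; rewrite inE.
have HBP x y : H x -> H y -> H (x - y).
  by move=> Hx Hy; have := HB x y; rewrite !inE; apply.
have DBP x y : D x -> D y -> D (x - y).
  by move=> Dx Dy; have := DB x y; rewrite !inE; apply.
have HN x : H x -> H (- x) by move=> Hx; rewrite -sub0r; exact: HBP.
have HD' x y : H x -> H y -> H (x + y).
  by move=> Hx Hy; rewrite -[y]opprK; apply: HBP => //; exact: HN.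
have [[h Hh h0]|nh] := pselect (exists2 h, H h & h <> 0); last first.
  left; apply/seteqP; split=> [x Hx|x ->] //=.
  by apply: contrapT => x0; apply: nh; exists x.
right; apply/seteqP; split=> // d Dd.
have [e He e0] : exists2 e : rat, H e & 0 < e.
  have [h1|h1] := ltP 0 (h : rat); first by exists h.
  by exists (- h); [exact: HN | rewrite oppr_gt0 lt_neqAle h1 andbT; apply/eqP].
have HMn n : H (e *+ n).
  by elim: n => [|n IHn]; rewrite ?mulr0n // mulrS; exact: HD'.
have pos x : D x -> (0 : rat) <= x -> H x.
  move=> Dx x0; have [n xn] := rat_le_nat (x / e).
  apply: (Hconv _ _ (HMn n) Dx); apply/andP; split=> //=.
  by rewrite -mulr_natl -ler_pdivrMr.
have [d0|d0] := leP 0 (d : rat); first exact: pos.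
rewrite -[d]opprK; apply: HN; apply: pos; last by rewrite oppr_ge0 ltW.
by rewrite -sub0r; apply: DBP => //; exact: HD.
Qed.

(** Transparent, so that its value at c reduces to [v (k c)]. *)
Definition comp_valuation (K F : fieldType) (G : orderedGroupType)
    (k : {rmorphism K -> F}) (v : valuation F G) : valuation K G.
Proof.
apply: (@Valuation _ _ (fun c => v (k c))).
- by move=> c; rewrite valuation_eq0; split=> [/eqP|->]; rewrite ?rmorph0 // fmorph_eq0 => /eqP.
- by move=> c d; rewrite rmorphM valuationM.
- by move=> c d; rewrite rmorphD; exact: valuationD.
Defined.

(** * The field K and the valuation on K(X) *)

Section Example.
Context (p : nat) (O : countClosedFieldType) (v : valuation O ratG) (t : O) (R : set O).
Hypotheses (O_char : p \in [pchar O]) (sR : is_subring R) (Rt : R t).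
Hypothesis vt : v t = Some (1 : rat).
Hypothesis R_int : forall f, R f -> f != 0 -> exists n : nat, v f = Some (n%:R : rat).

Let S := complete_perfect v R p.
Let sS : subfield S. Proof. exact: (complete_perfect_subfield O_char sR Rt vt). Qed.

Let p_prime : prime p. Proof. exact: pcharf_prime O_char. Qed.
Let p_gt1 : (1 < p)%N. Proof. exact: prime_gt1. Qed.
Let p_gt0 : (0 < p)%N. Proof. exact: prime_gt0. Qed.

Lemma root_tower : exists tau : nat -> O, tau 0%N = t /\ forall n, tau n.+1 ^+ p = tau n.
Proof.
have /choice[f fP] : forall y : O, exists z, z ^+ p = y by move=> y; exact: closed_root.
by exists (fun n => iter n f t); split=> // n; rewrite iterS fP.
Qed.

(** For the partial sums c_n of the series with terms 1/tau_i, i >= 1, a telescoping sum shows that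
    y = alpha - c_n satisfies y^p - y = 1/tau_n. The right side has value -1/p^n, so y has value
    -1/p^(n+1). *)
Lemma tower_centers (alpha : O) : alpha ^+ p - alpha = t^-1 ->
  exists c : nat -> O, forall n, S (c n) /\ v (alpha - c n) = Some (- (p%:R ^- n.+1) : rat).
Proof.
move=> alphaP; have [tau [tau0 tauS]] := root_tower.
have tau_t n : tau n ^+ (p ^ n) = t.
  by elim: n => [|n IHn]; rewrite ?expr1 // expnS exprM tauS.
have pr : p%:R != 0 :> rat by rewrite pnatr_eq0 -lt0n.
have v_tau n : v (tau n) = Some (p%:R ^- n : rat).
  have [g vg] : exists g, v (tau n) = Some g.
    apply: w_some; apply/eqP => tau_n0; have := tau_t n; rewrite tau_n0 expr0n.
    rewrite expn_eq0 gtn_eqF //= => /esym/eqP; apply/negP; exact: w_neq0 vt.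
  have := wX (p ^ n) vg; rewrite tau_t vt vg => -[gE]; congr Some.
  have : (g : rat) * (p%:R ^+ n) = 1 by rewrite -natrX mulr_natr gE.
  by move=> /(canRL (mulfK _)); rewrite mul1r; apply; rewrite expf_neq0.
have S_tau n : S (tau n).
  apply: sub_complete_perfect; exists n; rewrite tau_t; exact: quotients_t.
exists (fun n => \sum_(i < n) (tau i.+1)^-1) => n; split.
  by apply: (subfield_sum sS) => i _; apply: (subfieldV sS).
set y := alpha - _.
have yE : y ^+ p - y = (tau n)^-1.
  rewrite /y; elim: n {y} => [|n IHn]; first by rewrite big_ord0 subr0 tau0.
  rewrite big_ord_recr /= opprD addrA exprB_pchar // exprVn tauS -IHn; ring.
have vy' := wV (v_tau n).
have q_lt0 : - p%:R ^- n < 0 :> rat.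
  by rewrite oppr_lt0 invr_gt0 exprn_gt0 // ltr0n.
have [y0|[h vy h0]] := vge_total v y 0.
  exfalso; have : vge v 0 (tau n)^-1.
    by rewrite -yE; apply: vgeB => //; rewrite -(mul0rn _ p); exact: vgeX.
  by rewrite (vge_some _ vy') /= leNgt q_lt0.
have := w_artin_schreier O_char vy h0; rewrite yE vy' vy => -[hE]; congr Some.
have /(canRL (mulfK pr)) : (h : rat) * p%:R = - p%:R ^- n by rewrite mulr_natr hE.
by move=> ->; rewrite exprSr invfM mulNr.
Qed.

Section Subfield.
Context (K : fieldType) (k : {rmorphism K -> O}).
Hypothesis range_k : range k = S.
Let vK := comp_valuation k v.

Let Sk c : S (k c). Proof. by rewrite -range_k; exists c. Qed.

Let k_ex y : S y -> exists c, k c = y.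
Proof. by rewrite -range_k => -[c _ <-]; exists c. Qed.

Lemma K_perfect : perfect_of_char p K.
Proof.
split; first by rewrite -(fmorph_pchar k).
move=> c; have [_ /k_ex[d <-] dp] := complete_perfect_root O_char sR Rt vt (Sk c).
by exists d; apply: (fmorph_inj k); rewrite rmorphXn.
Qed.

Lemma K_henselian : henselian vK setT.
Proof.
move=> q a q0 [_ a0] qa dqa.
have [|||||b [/k_ex[c <-] rc ca]] :=
    @complete_perfect_henselian O v t R p O_char sR Rt vt (map_poly k q) (k a).
- by move=> i; rewrite coef_map; split; [exact: Sk | have [] := q0 i].
- exact: Sk.
- exact: a0.
- by rewrite horner_map.
- by rewrite deriv_map horner_map.
exists c; split; [|by rewrite fmorph_root in rc|by rewrite /= rmorphB].
split=> //; rewrite -[c](subrK a); apply: (@vgeD _ _ vK 0) => //.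
by apply: vgtW; rewrite /vgt /= rmorphB.
Qed.

Let S_t : S t.
Proof. by apply/sub_complete_perfect/sub_perfect_quotients; exact: quotients_t. Qed.

Lemma K_unbounded (g : rat) : exists c, vgt vK g c /\ c != 0.
Proof.
have [c kc] := k_ex S_t; have [n gn] := rat_le_nat g.
have vc : vK c = Some (1 : rat) by rewrite /= kc.
exists (c ^+ n.+1); split; last exact: w_neq0 (wX _ vc).
by rewrite (vgt_some _ (wX n.+1 vc)) /= (le_lt_trans gn) // ltr_nat.
Qed.

Lemma K_rank_one : rank_one (value_group vK setT).
Proof.
apply: rat_rank_one.
  split; first by rewrite inE; exists 1 => //; exact: w1.
  move=> g h; rewrite !inE => -[c _ vc] [d _ vd].
  by exists (c / d) => //; exact: wM vc (wV vd).
have [c kc] := k_ex S_t => D0; have : value_group vK setT (1 : rat).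
  by exists c => //; rewrite /= kc.
by rewrite D0 => /eqP.
Qed.

Lemma K_example : exists (w : valuation (ratfun K) ratG) (a : K) (gam : K -> rat),
  [/\ forall c, w (rat_const c) = vK c,
      forall c, w (rat_poly 'X - rat_const c) = Some (gam c),
      forall c, gam c < 0
    & vgt w 0 (rat_poly ('X^p - 'X - a%:P))] /\
  (forall y g, w y = Some g -> exists c, vgt w g (y - rat_const c)) /\
  exists z : nat -> K, (forall n, gam (z n) < gam (z n.+1)) /\
    forall d : rat, d < 0 -> exists n, d < gam (z n).
Proof.
have [a ka] : exists a, k a = t^-1 by apply: k_ex; exact: (subfieldV sS).
have [tK ktK] := k_ex S_t.
have [alpha alphaP] := closed_artin_schreier_root t^-1 p_gt1.
have gam_ex c : exists g : rat, v (alpha - k c) = Some g /\ g < 0.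
  have nP := no_pseudo_root O_char sR Rt vt R_int (Sk c).
  have [y0|[g vg g0]] := vge_total v (alpha - k c) 0; last by exists g.
  (* If alpha - c were integral, so would be c^p - c - 1/t. *)
  exfalso; apply: nP.
  rewrite (_ : _ - _ = - ((alpha - k c) ^+ p - (alpha - k c))); last first.
    by rewrite exprB_pchar // -alphaP; ring.
  by rewrite vgeN; apply: vgeB => //; rewrite -(mul0rn _ p); exact: vgeX.
have [gam gamP] := choice gam_ex.
have va c : v (alpha - k c) = Some (gam c) by case: (gamP c).
have gam_lt0 c : gam c < 0 by case: (gamP c).
have [c0 c0P] := tower_centers alphaP.
have z_ex n : exists d, k d = c0 n by apply: k_ex; case: (c0P n).
have [z zP] := choice z_ex.
have gam_z n : gam (z n) = - (p%:R ^- n.+1).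
  by have [_] := c0P n; rewrite -zP va => -[].
have pr : (0 : rat) < p%:R by rewrite ltr0n.
have z_incr n : gam (z n) < gam (z n.+1).
  rewrite !gam_z ltrN2 ltf_pV2 ?posrE ?exprn_gt0 // [_ ^+ n.+2]exprS.
  by rewrite ltr_pMl ?exprn_gt0 // ltr1n.
have z_sup d : d < 0 -> exists n, d < gam (z n).
  move=> d0; have [n gn] := rat_le_nat (- d)^-1; exists n; rewrite gam_z ltrNr.
  rewrite invf_plt ?posrE ?exprn_gt0 ?oppr_gt0 //; apply: (le_lt_trans gn).
  rewrite -natrX ltr_nat; apply: ltn_trans (ltn_expl n p_gt1) _.
  by rewrite ltn_exp2l.
have gam_sup (d : rat) : d < 0 -> exists c, d < gam c.
  by move=> /z_sup[n dn]; exists (z n).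
(* Diagonal argument: the n-th choice keeps the limit of [s] away from the n-th
   element of the countable field [O]. *)
pose r n : O := odflt 0 (unpickle n).
pose s := fix s n := if n is m.+1 then
  s m + (if vle (v (alpha + k (s m) - r m)) (Some (m.+1%:R : rat)) then 0 else tK ^+ m.+1)
  else 0 : K.
have vtX n : v (k (tK ^+ n)) = Some (n%:R : rat) by rewrite rmorphXn /= ktK; exact: wX vt.
have s_cauchy n m : (n <= m)%N -> vge v (n.+1%:R : rat) (k (s m) - k (s n)).
  move=> /subnK <-; elim: (m - n)%N => [|i IHi]; first by rewrite subrr vge0.
  rewrite addSn /= rmorphD addrAC; apply: vgeD => //.
  case: ifP => _; first by rewrite rmorph0 vge0.
  by rewrite (vge_some _ (vtX _)) /= ler_nat ltnS leq_addl.
have s_pos n : vge v (1 : rat) (k (s n)).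
  by have := s_cauchy 0%N n isT; rewrite /= rmorph0 subr0.
pose x n := alpha + k (s n).
have xB m n : x m - x n = k (s m) - k (s n) by rewrite /x; ring.
have x_avoids y : exists N h, forall n, (N <= n)%N ->
    v (x n - y) = Some h /\ forall m, (n <= m)%N -> vgt v h (x m - x n).
  pose n := pickle y; have rn : r n = y by rewrite /r pickleK.
  (* The choice made for r_n keeps this value at most n + 1, while all later corrections have values
     at least n + 2. *)
  have [h [vh hn]] : exists h : rat, v (x n.+1 - y) = Some h /\ h <= n.+1%:R.
    rewrite /x /= rmorphD addrA -/(x n) rn; case: ifP.
      rewrite rmorph0 addr0 => xn; case E: (v _) xn => [h|] //= hn.
      by exists h.
    move=> /negbT xn; exists n.+1%:R; split=> //.
    by rewrite addrAC addrC; apply: (wDl (vtX _)).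
  have far m l : (n.+1 <= l)%N -> (l <= m)%N -> vgt v h (x m - x l).
    move=> nl lm; rewrite xB; apply: vge_lt (s_cauchy _ _ lm).
    by rewrite /= (le_lt_trans hn) // ltr_nat ltnS.
  exists n.+1, h => m nm; split=> [|l ml]; last exact: far.
  by rewrite -(subrK (x n.+1) (x m)) -addrA addrC; apply: (wDl vh); exact: far.
pose P : {poly K} := 'X^p - 'X - a%:P.
have P_alpha : (map_poly k P).[alpha] = 0.
  rewrite /P !rmorphB /= map_polyXn map_polyX map_polyC !hornerE /= ka -alphaP; ring.
have dense_x (Q : {poly K}) n h : v (map_poly k Q).[x n] = Some h ->
    exists c, vgt v h ((map_poly k Q).[x n] - k c).
  (* Q(x_n) = Q(alpha + s_n) is the value at alpha of a polynomial over [K]. As P(alpha) = 0, it can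
     be reduced modulo [P] to degree less than p, where [stable_approx] applies. *)
  pose Q1 := Q \Po ('X + (s n)%:P).
  have -> : (map_poly k Q).[x n] = (map_poly k (Q1 %% P)).[alpha].
    have -> : (map_poly k Q).[x n] = (map_poly k Q1).[alpha].
      by rewrite /Q1 map_comp_poly horner_comp rmorphD /= map_polyX map_polyC !hornerE.
    rewrite {1}(divp_eq Q1 P) rmorphD rmorphM /= hornerD hornerM P_alpha.
    by rewrite mulr0 add0r.
  move=> vQ; have r0 : Q1 %% P != 0.
    by apply/eqP => r0; move: vQ; rewrite r0 rmorph0 horner0 w0.
  have rp : (size (Q1 %% P)%R <= p)%N.
    have sP : size P = p.+1 by exact: size_artin_schreier.
    by rewrite -ltnS -sP ltn_modp -size_poly_gt0 sP.
  have K_char : p \in [pchar K] by case: K_perfect.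
  have [rho [d d0 dP]] := @stable_approx K O vK v k alpha gam p K_char K_henselian
    (fun c => erefl) va gam_sup gam_lt0 _ rp r0.
  have [c /dP[vc cP]] := gam_sup d d0; exists (Q1 %% P).[c].
  suff -> : h = rho by [].
  have : v (map_poly k (Q1 %% P)).[alpha] = Some rho.
    by apply: (wBr (x := k (Q1 %% P).[c])) => //; rewrite -vgtN opprB.
  by rewrite vQ => -[].
pose w := limit_valuation k x_avoids.
exists w, a, gam; split.
  split=> //.
  - exact: limit_valuation_const.
  - move=> c; rewrite /rat_const -rat_polyB; apply: limit_valuation_poly.
    exists 0%N => n _; rewrite rmorphB /= map_polyX map_polyC !hornerE.
    rewrite /x addrAC; apply: (wDl (va c)).
    by apply: vge_lt (s_pos n); rewrite /= (lt_trans (gam_lt0 c)).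
  - apply: limit_valuation_poly_gt; exists 0%N => n _.
    have -> : (map_poly k P).[x n] = k (s n) ^+ p - k (s n).
      rewrite /P !rmorphB /= map_polyXn map_polyX map_polyC !hornerE /= ka -alphaP.
      rewrite /x exprD_pchar //; ring.
    have s0 : vge v (0 : rat) (k (s n)) by apply: vge_le (s_pos n).
    apply: vgtB; last by apply: vge_lt (s_pos n).
    by apply: vge_lt (vgeX p (s_pos n)); rewrite /= ltr0n.
split; last by exists z.
exact: limit_valuation_dense dense_x.
Qed.

End Subfield.
End Example.

(** * Henselizations *)

(** The p elements of the prime field already exhaust the roots of X^p - X. *)
Lemma Frobenius_fixed (F : fieldType) p (u : F) :
  p \in [pchar F] -> u ^+ p = u -> exists n : nat, u = n%:R.
Proof.
move=> p_char up; have p_prime := pcharf_prime p_char; have p_gt1 := prime_gt1 p_prime.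
apply: contrapT => nu; pose q : {poly F} := 'X^p - 'X - 0%:P.
have q0 : q != 0 by rewrite -size_poly_gt0 size_artin_schreier.
have root_q y : root q y = (y ^+ p == y).
  by rewrite /root !hornerE subr0 subr_eq0.
pose s : seq F := u :: [seq i%:R | i <- iota 0 p].
suff : (size s < size q)%N by rewrite size_artin_schreier // /s /= size_map size_iota ltnn.
apply: max_poly_roots q0 _ _.
  rewrite /= root_q up eqxx; apply/allP => _ /mapP[i _ ->].
  by rewrite root_q -(pFrobenius_autE p_char) pFrobenius_aut_nat.
rewrite /s /=; apply/andP; split.
  by apply/negP => /mapP[i _ ui]; apply: nu; exists i.
rewrite map_inj_in_uniq ?iota_uniq // => i j.
wlog ij : i j / (i <= j)%N => [wlog_le|] ip jp ijF.
  have [ij|/ltnW ji] := leqP i j; first exact: wlog_le.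
  by apply/esym; apply: wlog_le.
apply/eqP; rewrite eqn_leq ij -subn_eq0 /=.
have : (p %| j - i)%N by rewrite (dvdn_pcharf p_char) natrB // ijF subrr.
rewrite mem_iota add0n in jp.
by rewrite /dvdn modn_small // (leq_ltn_trans (leq_subr _ _)).
Qed.

Lemma deriv_artin_schreier (R : comNzRingType) (a : R) p :
  p \in [pchar R] -> ('X^p - 'X - a%:P)^`() = - 1.
Proof.
by move=> p_char; rewrite !derivE -scaler_nat (pcharf0 p_char) scale0r sub0r subr0.
Qed.

Section HenselizationBounds.
Context (F : fieldType) (G : orderedGroupType) (w : valuation F G).

Lemma henselization_min (E : set F) : E `<=` henselization w E.
Proof. by move=> x Ex H [_ EH]; exact: EH. Qed.

Lemma henselization_sub (E E' : set F) :
  (forall H, subfield H -> henselian w H -> E' `<=` H -> E `<=` H) ->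
  henselization w E `<=` henselization w E'.
Proof. by move=> EE x Ex H [[sH hH] E'H]; apply: Ex; split=> //; exact: EE. Qed.

(** Both sides are intersections, so it suffices that the two sets lie in the same henselian
    subfields. *)
Lemma henselization_eq (E E' : set F) :
  (forall H, subfield H -> henselian w H -> E `<=` H <-> E' `<=` H) ->
  henselization w E = henselization w E'.
Proof.
by move=> EE; apply/seteqP; split; apply: henselization_sub => H sH hH EH; apply/EE.
Qed.

(* [X^p - X - y] has at most one root of positive value. *)
Lemma henselian_artin_schreier (E : set F) p (y b : F) :
  p \in [pchar F] -> subfield E -> henselian w E -> E y -> vgt w 0 y ->
  b ^+ p - b = y -> vgt w 0 b -> E b.
Proof.
move=> p_char sE hE Ey y0 by_ b0; have p_prime := pcharf_prime p_char.
have p0 := prime_gt0 p_prime.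
pose q : {poly F} := 'X^p - 'X - y%:P.
have q_0 : q.[0] = - y by rewrite !hornerE expr0n gtn_eqF // sub0r oppr0 add0r.
have dq : q^`().[0] = -1.
  by rewrite /q deriv_artin_schreier // !hornerE.
have ER x : E x -> vge w 0 x -> valuation_ring w E x by [].
have R1 : valuation_ring w E 1 by apply: ER; [exact: subfield1 | exact/vge_eq/w1].
have R0 : valuation_ring w E 0 by apply: ER; [exact: subfield0 | exact: vge0].
have RB x z : valuation_ring w E x -> valuation_ring w E z -> valuation_ring w E (x - z).
  by move=> [Ex x0] [Ez z0]; apply: ER; [exact: subfieldB | exact: vgeB].
have [|||| b' [[Eb' _] rb' b'0]] := hE q 0.
- move=> i; rewrite !coefB coefXn coefX coefC; apply: (RB); first apply: RB.
  + by case: eqP.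
  + by case: eqP.
  + by case: eqP => // _; apply: ER => //; exact: vgtW.
- exact: R0.
- by rewrite q_0 -/(vgt w 0 _) vgtN.
- by rewrite dq wN w1.
rewrite subr0 in b'0; suff -> : b = b' by [].
apply/eqP; rewrite -subr_eq0; apply/negPn/negP => d0.
have dp : (b - b') ^+ p = b - b'.
  rewrite exprB_pchar //; move: rb'; rewrite /root !hornerE subr_eq0 => /eqP b'y.
  by apply/eqP; rewrite -subr_eq0 -(subrr y) -{1}by_ -b'y; apply/eqP; ring.
have w_d : w (b - b') = Some 0.
  apply: (@w_unity _ _ w p.-1); first by rewrite -ltnS prednK // prime_gt1.
  by apply: (mulfI d0); rewrite -exprS prednK // mulr1.
by have := vgtB b0 b'0; rewrite (vgt_some _ w_d) ltxx.
Qed.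

End HenselizationBounds.

(** * Approximation inside an algebraic closure of K(X) *)

Section AlgebraicClosure.
Context (M : fieldType) (w : valuation M ratG).
Context (L : closedFieldType) (i : {rmorphism M -> L}) (G : orderedGroupType).
Context (j : {additive ratG -> G}) (wL : valuation L G) (p : nat).
Hypothesis p_char : p \in [pchar M].
Hypothesis i_alg : forall y, algebraicOver i y.
Hypothesis j_mono : {mono j : x y / x <= y}.
Hypothesis wLi : forall x, wL (i x) = omap j (w x).

Let C := vclosure wL (range i).

Lemma vgt_i g x : vgt w g x -> vgt wL (j g) (i x).
Proof.
rewrite /vgt wLi; case: (w x) => [h|] //=.
by rewrite /vlt /= j_mono.
Qed.

Lemma w_i x g : w x = Some g -> wL (i x) = Some (j g).
Proof. by rewrite wLi => ->. Qed.

Let j_lt g h : (j g < j h) = (g < h).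
Proof. by rewrite !og_ltNge j_mono. Qed.

(** Take an equation for [y] with nonzero constant term. If the value of [y] exceeded all values of
    [M], every other term would have a larger value than the constant one. *)
Lemma i_cofinal : cofinal_values wL (range i).
Proof.
move=> y h wy; have y0 := w_neq0 wy; apply: contrapT => nh.
have lt_h g : value_group wL (range i) g -> g < h.
  by move=> Dg; rewrite og_ltNge; apply/negP => hg; apply: nh; exists g.
have [q q0 ry] := i_alg y.
have [n [r nr qE]] := multiplicity_XsubC q 0; rewrite q0 /= in nr.
have r0 : r`_0 != 0 by rewrite -horner_coef0.
have ry' : (map_poly i r).[y] = 0.
  move: ry; rewrite qE rmorphM rmorphXn /= map_polyXsubC rmorph0 subr0 /root.
  by rewrite hornerM mulf_eq0 !hornerE (negPf (expf_neq0 _ y0)) orbF => /eqP.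
have [g wr0] := w_some w r0.
have D x g' : w x = Some g' -> value_group wL (range i) (j g').
  by move=> /w_i wx; exists (i x) => //; exists x.
have h0 : 0 < h by rewrite -(raddf0 j); apply: lt_h; exact: (D 1 0 (w1 w)).
have : vgt wL (j g) (i r`_0).
  have -> : i r`_0 = - \sum_(k < (size r).-1) i r`_k.+1 * y ^+ k.+1.
    apply/eqP; rewrite -addr_eq0; apply/eqP; move: ry'.
    rewrite (@horner_coef_wide _ (size r).-1.+1) ?size_map_poly ?leqSpred //.
    rewrite big_ord_recl expr0 mulr1 coef_map; congr (_ + _ = _).
    by apply: eq_bigr => k _; rewrite coef_map.
  rewrite vgtN; apply: vgt_sum => k _.
  have [rk|rk] := eqVneq r`_k.+1 0; first by rewrite rk rmorph0 mul0r vgt0.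
  have [gk wrk] := w_some w rk.
  have yg : vgt wL (j (g - gk)) y.
    by rewrite (vgt_some _ wy); apply: lt_h; exact: (D _ _ (wM wr0 (wV wrk))).
  have yk : vge wL 0 (y ^+ k).
    by rewrite -(mul0rn _ k); apply: vgeX; rewrite (vge_some _ wy) ltW.
  rewrite mulrC exprS -mulrA.
  have := vgtM yg (vgeM yk (vge_eq (w_i wrk))).
  by rewrite add0r -raddfD subrK.
by rewrite (vgt_some _ (w_i wr0)) ltxx.
Qed.

Lemma closure_subfield : subfield C.
Proof. by apply: vclosure_subfield; [exact: subfield_range | exact: i_cofinal]. Qed.

Lemma sub_closure x : C (i x).
Proof. by apply: sub_vclosure; exists x. Qed.

Let L_char : p \in [pchar L]. Proof. by rewrite (fmorph_pchar i). Qed.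
Let p_prime : prime p. Proof. exact: pcharf_prime p_char. Qed.

(* [b = b^p - y] gives approximations of [b] in [M] up to [b^(p^n)]. *)
Lemma artin_schreier_closure y b : vgt w 0 y -> b ^+ p - b = i y -> vgt wL 0 b -> C b.
Proof.
move=> y0 by_ b0; have [->|nb0] := eqVneq b 0.
  by rewrite -(rmorph0 i); exact: sub_closure.
have [h wb] := w_some wL nb0; rewrite (vgt_some _ wb) in b0.
have wy : wL (i y) = Some h.
  rewrite -by_ wBC; apply: (wDl wb); rewrite vgtN (vgt_some _ (wX p wb)).
  case: (p) (prime_gt1 p_prime) => [|[|n]] // _; rewrite mulrS.
  rewrite -[X in X < _]addr0 og_ltD2l -(mul0rn _ n.+1).
  exact: og_ltMn.
have [g wyg] : exists g, w y = Some g.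
  by move: wy; rewrite wLi; case: (w y) => // g; exists g.
have hg : h = j g by move: wy; rewrite (w_i wyg) => -[].
have g0 : (0 : rat) < g by rewrite (vgt_some _ wyg) in y0.
have approx n : exists x, vge wL (j (g *+ n.+1)) (b - i x).
  elim: n => [|n [x bx]]; first by exists 0; rewrite rmorph0 subr0 (vge_some _ wb) hg.
  exists (x ^+ p - y).
  have -> : b - i (x ^+ p - y) = (b - i x) ^+ p.
    by rewrite exprB_pchar // rmorphB rmorphXn /= -by_; ring.
  apply: vge_le (vgeX p bx).
  rewrite -raddfMn j_mono /= -mulrnA ler_pMn2l //.
  have := prime_gt1 p_prime; nia.
move=> gL [_ [x _ <-]]; rewrite wLi; case wx: (w x) => [q|] //= [<-].
have [n qn] := rat_le_nat (q / g).
have [x' bx'] := approx n; exists (i x'); first by exists x'.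
apply: vge_lt bx'; rewrite j_lt /= -mulr_natl.
by rewrite -ltr_pdivrMr // (le_lt_trans qn) // ltr_nat.
Qed.

Lemma closure_dense y h : C y -> wL y = Some h ->
  exists x g, [/\ w x = Some g, h = j g & vgt wL h (y - i x)].
Proof.
move=> Cy wy; have [g Dg hg] := i_cofinal wy.
have [_ [x _ <-] yx] := Cy _ Dg; have yx' := vgt_le hg yx.
have wx := wBr wy yx'; move: (wx); rewrite wLi; case E: (w x) => [g'|] //= [jg].
by exists x, g'.
Qed.

(** Modulo the maximal ideal, 0 is a simple root of X^p - X - y. *)
Lemma artin_schreier_root_pos y : vgt w 0 y ->
  exists2 b, b ^+ p - b = i y & vgt wL 0 b.
Proof.
move=> y0; have y0' : vgt wL 0 (i y) by rewrite -(raddf0 j); exact: vgt_i.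
have p0 := prime_gt0 p_prime.
have [||b rb b0] := @closed_henselian L G wL ('X^p - 'X - (i y)%:P) 0.
- by rewrite !hornerE expr0n gtn_eqF // sub0r oppr0 add0r vgtN.
- by rewrite deriv_artin_schreier // !hornerE wN w1.
exists b; last by rewrite subr0 in b0.
by move: rb; rewrite /root !hornerE subr_eq0 => /eqP.
Qed.

Lemma henselization_artin_schreier (E : set L) y b :
  subfield E -> henselian wL E -> range i `<=` E ->
  vgt w 0 y -> b ^+ p - b = i y -> vgt wL 0 b -> E b.
Proof.
move=> sE hE iE y0 by_ b0.
apply: (henselian_artin_schreier L_char sE hE _ _ by_ b0); first by apply: iE; exists y.
by rewrite -(raddf0 j); exact: vgt_i.
Qed.

End AlgebraicClosure.

(** * The example *)

Lemma increasing_approximating (K : fieldType) (v : valuation K ratG)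
    (w : valuation (ratfun K) ratG) (gam : K -> rat) (z : nat -> K) :
  (forall c, w (rat_const c) = v c) ->
  (forall c, w (rat_poly 'X - rat_const c) = Some (gam c)) ->
  (forall c, gam c < 0) ->
  (forall n, gam (z n) < gam (z n.+1)) ->
  (forall d : rat, d < 0 -> exists n, d < gam (z n)) ->
  approximating v w z.
Proof.
move=> wk wx gam_lt0 z_incr z_sup.
have incr : {homo (gam \o z) : m n / (m < n)%N >-> m < n}.
  by apply: (homo_ltn (r := fun a b : rat => a < b)) => // a b c; exact: lt_trans.
have vz c c' : gam c < gam c' -> v (c - c') = Some (gam c).
  move=> cc'; rewrite wBC.
  exact: (@v_sub_center _ _ v w (const_rmorphism K) (rat_poly 'X) gam wk wx).
have succ_ltn m n : successor m n -> (m < n)%N by case; rewrite ltEnat.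
split.
- split; [exact: inhabits 0%N | | by move=> m; exists m.+1; rewrite ltEnat /=].
  by apply: (Wf_nat.well_founded_lt_compat _ id) => m n; rewrite ltEnat => /ssrnat.ltP.
- move=> m n l mn nl; rewrite (vz _ _ (incr _ _ mn)) (vz _ _ (incr _ _ nl)).
  by rewrite /vlt /= -ltNge; exact: incr mn.
(* At a centre z_n closer to X than [c], the value of c - z_n is [gam c], whereas a limit would
   require [gam (z n)]. *)
- move=> [c cz]; have [n gn] := z_sup _ (gam_lt0 c).
  have nS : successor n n.+1 by split; [exact: ltnSn | move=> l; rewrite ltEnat leEnat].
  have := cz n n.+1 nS; rewrite (vz _ _ gn) (vz _ _ (z_incr n)) => -[E].
  by move: gn; rewrite E ltxx.
- move=> m n /succ_ltn mn; rewrite wx /= -rat_constB wk.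
  by rewrite vz //; exact: incr mn.
Qed.

Section ArtinSchreierMap.
Context (R : comNzRingType) (p : nat).
Hypothesis p_char : p \in [pchar R].
Implicit Types x y : R.

Lemma artin_schreierB x y : (x - y) ^+ p - (x - y) = (x ^+ p - x) - (y ^+ p - y).
Proof. by rewrite exprB_pchar //; ring. Qed.

Lemma artin_schreierN x : (- x) ^+ p - (- x) = - (x ^+ p - x).
Proof.
have := artin_schreierB 0 x.
by rewrite expr0n gtn_eqF ?(prime_gt0 (pcharf_prime p_char)) // mulr0n subrr !sub0r.
Qed.

Lemma artin_schreierD x y : (x + y) ^+ p - (x + y) = (x ^+ p - x) + (y ^+ p - y).
Proof. by rewrite -{1 2}[y]opprK artin_schreierB artin_schreierN opprK. Qed.

End ArtinSchreierMap.

Section Final.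
Context (p : nat) (K : fieldType) (v : valuation K ratG) (w : valuation (ratfun K) ratG).
Context (a : K) (gam : K -> rat).
Hypotheses (K_char : p \in [pchar K]) (p_odd : odd p) (hv : henselian v setT).
Hypothesis unbounded : forall g : rat, exists c, vgt v g c /\ c != 0.
Hypotheses (wk : forall c, w (rat_const c) = v c).
Hypotheses (wx : forall c, w (rat_poly 'X - rat_const c) = Some (gam c)).
Hypotheses (gam_sup : forall d : rat, d < 0 -> exists c, d < gam c).
Hypotheses (gam_lt0 : forall c, gam c < 0).
Let P : {poly K} := 'X^p - 'X - a%:P.
Hypothesis wP : vgt w 0 (rat_poly P).
Hypothesis w_dense : forall y g, w y = Some g -> exists c, vgt w g (y - rat_const c).

(** Written so as to be visibly the case e = -X^2 of P^2 + e^p - e. *)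
Definition example_poly : {poly K} := P ^+ 2 + ((- 'X^2) ^+ p - (- 'X^2)).
Let f := example_poly.

Let wv y g : w y = Some g -> exists c, v c = Some g.
Proof. by move=> wy; have [c yc] := w_dense wy; exists c; rewrite -wk; exact: wBr wy yc. Qed.

Let poly_char : p \in [pchar {poly K}]. Proof. exact: (rmorph_pchar (@polyC K)). Qed.
Let ratfun_char : p \in [pchar ratfun K].
Proof. by rewrite (fmorph_pchar (const_rmorphism K)). Qed.

Lemma f_artin_schreier : f = P ^+ 2 - ('X^2 ^+ p - 'X^2).
Proof. by rewrite /f /example_poly artin_schreierN. Qed.

Let iX2 (L : fieldType) (i : {rmorphism ratfun K -> L}) :
  i (rat_poly f) = i (rat_poly (P ^+ 2))
    - (i (rat_poly 'X^2) ^+ p - i (rat_poly 'X^2)).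
Proof.
by rewrite f_artin_schreier !rat_polyB (rat_polyXn 'X^2 p) !rmorphB (rmorphXn i p).
Qed.

Let P_pos : vgt w 0 (map_poly (const_rmorphism K) P).[rat_poly 'X].
Proof. by rewrite -rat_polyE. Qed.

Let wk' c : w (const_rmorphism K c) = v c. Proof. exact: wk. Qed.
Let wx' c : w (rat_poly 'X - const_rmorphism K c) = Some (gam c). Proof. exact: wx. Qed.

Lemma example_immediate : immediate w (range rat_const) setT.
Proof.
apply: dense_immediate => //.
by move=> y g _ /w_dense[c yc]; exists (rat_const c) => //; exists c.
Qed.

Section Sequence.
Context (d : Order.disp_t) (I : orderType d) (z : I -> K).
Hypothesis zP : approximating v w z.

Lemma example_degree : approx_degree v w z f p.
Proof.
apply: (near_approx_degree wk wx gam_sup wv zP (l := gam 0 *+ p)).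
  exact: prime_gt0 (pcharf_prime K_char).
have := as_poly_degree_p K_char wk' wx' gam_lt0 P_pos p_odd.
by apply: nearS => c; rewrite -rat_polyE.
Qed.

Lemma example_degree_ge F : artin_schreier p setT (F - f) ->
  exists h, approx_degree v w z F h /\ (p <= h)%N.
Proof.
move=> [g _ gF]; pose e := g - 'X^2.
have FE : F = P ^+ 2 + (e ^+ p - e).
  by rewrite -(subrK f F) -gF f_artin_schreier /e artin_schreierB // addrCA.
have [l [n [pn near_n]]] := as_poly_degree K_char hv wk' wx' gam_sup gam_lt0 P_pos p_odd e.
exists n; split=> //; apply: (near_approx_degree wk wx gam_sup wv zP (l := l)).
  exact: leq_trans (prime_gt0 (pcharf_prime K_char)) pn.
by rewrite FE; apply: nearS near_n => c; rewrite -rat_polyE.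
Qed.

Lemma linear_degree e : e != 0 -> approx_degree v w z (e%:P * 'X) 1.
Proof.
move=> e0; have [g ve] := w_some v e0.
apply: (near_approx_degree wk wx gam_sup wv zP (l := g)) => //.
exists (-1) => // c _; rewrite hornerM hornerC hornerX rat_polyM rat_constM.
rewrite -/(rat_const e) -mulrBr; apply: wM (wx c).
by rewrite wk.
Qed.

End Sequence.

Lemma P_square_pos : vgt w 0 (rat_poly (P ^+ 2)).
Proof. by rewrite expr2 rat_polyM -[X in vgt _ X]addr0; apply: vgtM (vgtW wP). Qed.

Section Closure.
Context (L : closedFieldType) (i : {rmorphism ratfun K -> L}) (G : orderedGroupType).
Context (j : {additive ratG -> G}) (wL : valuation L G).
Hypothesis i_alg : forall y : L, algebraicOver i y.
Hypothesis j_mono : {mono j : x y / x <= y}.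
Hypothesis wLi : forall x : ratfun K, wL (i x) = omap j (w x).

Let L_char : p \in [pchar L]. Proof. by rewrite (fmorph_pchar i). Qed.

Lemma example_reduction : exists e, e != 0 /\
  artin_schreier p (henselization wL (range i)) (i (rat_poly (e%:P * 'X - f))).
Proof.
(* Here [gam 0] is the value of X, so that eX has positive value. *)
have [e [ve e0]] := unbounded (- gam 0); exists e; split=> //.
pose y := rat_poly (e%:P * 'X - P ^+ 2).
have y0 : vgt w 0 y.
  rewrite /y rat_polyB; apply: vgtB P_square_pos.
  rewrite rat_polyM -[rat_poly 'X]subr0 -[in X in _ * X]rat_const0.
  have ve' : vgt w (- gam 0) (rat_const e) by rewrite /vgt wk.
  by have := vgtM ve' (vge_eq (wx 0)); rewrite addNr.
have [b by_ b0] := artin_schreier_root_pos ratfun_char j_mono wLi y0.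
(* The polynomial eX - f is the sum of eX - P^2, the Artin-Schreier image of [b], and of the image
   of X^2. *)
exists (b + i (rat_poly 'X^2)).
  move=> H [[sH hH] iH]; apply: (subfieldD sH); last by apply: iH; exists (rat_poly 'X^2).
  exact: (henselization_artin_schreier ratfun_char j_mono wLi sH hH iH y0 by_ b0).
rewrite artin_schreierD // by_ rat_polyB rmorphB iX2 /y rat_polyB rmorphB.
by rewrite [in RHS]opprB -addrA; congr (_ + _); rewrite addrC.
Qed.

Variable theta : L.
Hypothesis thetaP : theta ^+ p - theta = i (rat_poly f).
Let E := generated_subfield (range i `|` [set theta]).
Let k : K -> L := i \o rat_const.

(** The elements [theta] and b - X^2 have the same Artin-Schreier image, so they differ by an
    element of the prime field. H is left arbitrary because it will be a topological closure in one
    use and a henselian field in the other. *)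
Lemma theta_mem : exists b, [/\ b ^+ p - b = i (rat_poly (P ^+ 2)), vgt wL 0 b
  & forall H, subfield H -> range i `<=` H -> H b -> H theta].
Proof.
have [b by_ b0] := artin_schreier_root_pos ratfun_char j_mono wLi P_square_pos.
exists b; split=> // H sH iH Hb.
pose u := theta - b + i (rat_poly 'X^2).
have up : u ^+ p = u.
  apply/eqP; rewrite -subr_eq0 /u artin_schreierD // artin_schreierB // by_ thetaP.
  by rewrite iX2 addrAC subrK subrr.
have [n un] := Frobenius_fixed L_char up.
rewrite (_ : theta = n%:R + b - i (rat_poly 'X^2)); last by rewrite -un /u; ring.
apply: (subfieldB sH); last by apply: iH; exists (rat_poly 'X^2).
by apply: (subfieldD sH) => //; exact: subfield_nat.
Qed.

(** The generator is X itself: [theta] lies in every henselian subfield that contains K(X).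
    Immediacy combines two approximations, that of K(X, theta) by K(X) inside the topological
    closure and that of K(X) by K. *)
Lemma example_henselian_rational : henselian_rational wL k E.
Proof.
have [b [by_ b0 memH]] := theta_mem.
have kE : k = i \o const_rmorphism K by [].
split.
  apply: dense_immediate.
  - move=> _ [c _ <-] H [_ iH]; apply: iH; left; exists (rat_const c) => //.
  - by exists 0 => //; rewrite kE /= !rmorph0.
  have EC : E `<=` vclosure wL (range i).
    have sC := closure_subfield i_alg wLi.
    have iC : range i `<=` vclosure wL (range i) by exact: sub_vclosure.
    move=> y; apply; split=> // x [|->]; first exact: iC.
    apply: memH => //.
    exact: (artin_schreier_closure ratfun_char j_mono wLi P_square_pos by_ b0).
  move=> y h Ey wy.
  have [x [g [wxg hg yx]]] := closure_dense i_alg wLi (EC _ Ey) wy.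
  have [c xc] := w_dense wxg; exists (k c); first by exists c.
  rewrite (_ : y - k c = (y - i x) + i (x - rat_const c)); last by rewrite rmorphB /k /=; ring.
  by apply: vgtD => //; rewrite hg; apply: (vgt_i j_mono wLi).
have iXE : E (i (rat_poly 'X)) by move=> H [_ iH]; apply: iH; left; exists (rat_poly 'X).
have i_poly F : i (rat_poly F) = (map_poly k F).[i (rat_poly 'X)].
  by rewrite rat_polyE -horner_map -map_poly_comp.
exists (i (rat_poly 'X)); split.
- exact: henselization_min.
- move=> [q q0]; rewrite /root -i_poly fmorph_eq0 rat_poly_eq0.
  exact/negP.
apply: henselization_eq => H sH hH; split=> EH.
  move=> y yY; apply: yY; split=> // x [[c _ <-]|->]; last exact: EH.
  by apply: EH => H' [_ iH']; apply: iH'; left; exists (rat_const c).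
have iH : range i `<=` H.
  have XH : H (i (rat_poly 'X)) by apply: EH => H' [_ H'X]; apply: H'X; right.
  have kH c : H (k c) by apply: EH => H' [_ H'k]; apply: H'k; left; exists c.
  have polyH F : H (i (rat_poly F)).
    rewrite i_poly; apply: (subfield_horner sH) => // n.
    by rewrite kE coef_map; exact: kH.
  move=> _ [y _ <-]; have [[N D] [_ ->]] := ratfun_frac y.
  by rewrite fmorph_div; apply: (subfield_div sH).
move=> y; apply; split=> // x [|->]; first exact: iH.
apply: (memH H sH iH).
exact: (henselization_artin_schreier ratfun_char j_mono wLi sH hH iH P_square_pos by_ b0).
Qed.

End Closure.
End Final.

Theorem theorem1p5 (p : nat) (p_prime : prime p) (p_odd : odd p) :
  exists (K : fieldType) (G : orderedGroupType)
         (v : valuation K G) (w : valuation (ratfun K) G) (f : {poly K}),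
  [/\ perfect_of_char p K, henselian v setT, rank_one (value_group v setT),
      (forall a : K, w (rat_const a) = v a)
    & immediate w (range rat_const) setT] /\
  (exists (d : Order.disp_t) (I : orderType d) (z : I -> K),
     approximating v w z) /\
  forall (d : Order.disp_t) (I : orderType d) (z : I -> K),
    approximating v w z ->
    [/\ approx_degree v w z f p,
        (forall F : {poly K}, artin_schreier p setT (F - f) ->
           exists h : nat, approx_degree v w z F h /\ (p <= h)%N)
      & forall (L : closedFieldType) (iota : {rmorphism ratfun K -> L})
               (G' : orderedGroupType) (j : {additive G -> G'})
               (wL : valuation L G'),
          (forall y : L, algebraicOver iota y) ->
          {mono j : x y / x <= y} ->
          (forall x : ratfun K, wL (iota x) = omap j (w x)) ->
          (exists g : {poly K},
             artin_schreier p (henselization wL (range iota))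
               (iota (rat_poly (g - f)))
             /\ approx_degree v w z g 1) /\
          (forall theta : L, theta ^+ p - theta = iota (rat_poly f) ->
             henselian_rational wL (iota \o rat_const)
               (generated_subfield (range iota `|` [set theta])))].
Proof.
have [O [vO [t [R [O_char sR Rt vt R_int]]]]] := valued_closed_field p_prime.
have sS := complete_perfect_subfield O_char sR Rt vt.
have [K [k range_k]] := subfield_as_field sS.
have K_perf := K_perfect O_char sR Rt vt range_k.
have K_hens := K_henselian O_char sR Rt vt range_k.
have [w [a [gam [[wk wx gam_lt0 wP] [w_dense [z [z_incr z_sup]]]]]]] :=
  K_example O_char sR Rt vt R_int range_k.
have gam_sup (d : rat) : d < 0 -> exists c, d < gam c.
  by move=> /z_sup[n dn]; exists (z n).
have unb := K_unbounded sR Rt vt range_k.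
have [K_char _] := K_perf.
exists K, ratG, (comp_valuation k vO), w, (example_poly p a); split.
  by split=> //; [exact: (K_rank_one sR Rt vt range_k) | exact: example_immediate].
split.
  exists _, (nat : orderType _), z.
  exact: (increasing_approximating wk wx gam_lt0 z_incr z_sup).
move=> d I z' z'P; split.
- exact: (example_degree K_char p_odd wk wx gam_sup gam_lt0 wP w_dense z'P).
- exact: (example_degree_ge K_char p_odd K_hens wk wx gam_sup gam_lt0 wP w_dense z'P).
- move=> L iota G' j wL i_alg j_mono wLi; split.
    have [e [e0 eP]] := example_reduction K_char unb wk wx wP j_mono wLi.
    exists (e%:P * 'X); split=> //.
    exact: (linear_degree wk wx gam_sup w_dense z'P e0).
  move=> theta thetaP.
  exact: (example_henselian_rational K_char wP w_dense i_alg j_mono wLi thetaP).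
Qed.
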